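(* Let $\mu \ne 0$, let $\tau_L(\varepsilon),\delta_L(\varepsilon),\tau_R(\varepsilon),\delta_R(\varepsilon)$ vary smoothly with a real parameter $\varepsilon$ near $0$, let $\mathcal{X},\mathcal{Y}$ be words on $\{L,R\}$ with $\mathcal{X}$ primitive and $\mathcal{X}_0 \ne \mathcal{Y}_0$, and let $\mathcal{S}[k]=\mathcal{X}^k\mathcal{Y}$. Suppose that when $\varepsilon=0$: (a) there exist infinitely many $k\ge 1$ for which the border-collision normal form has a unique, admissible, stable $\mathcal{S}[k]$-cycle that has no points on the switching manifold; (b) the eigenvalues of $M_{\mathcal{X}}(0)$ satisfy $0\le\lambda_1(0)<1<\lambda_2(0)$, and the eigenvector $\zeta_2(0)$ corresponding to $\lambda_2(0)$ is not a scalar multiple of $[0,1]^{\sf T}$; (c) $\min_i \left| x^{\mathcal{S}[k]}_i(0)\right| \not\to 0$ as $k\to\infty$. If $\gamma_{12}(0)\gamma_{21}(0)=-1$, suppose in addition that $\lambda_1'(0)\lambda_2(0)+\lambda_1(0)\lambda_2'(0)<0$. Then there exist $k_{\rm min}\in\mathbb{Z}$ and $\Delta>0$ such that for all $k\ge k_{\rm min}$ and $0<\varepsilon\le\Delta\lambda_2^{-k}(0)$, the $\mathcal{S}[k]$-cycle is admissible and attracting.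
   Context: For real $\tau_L,\delta_L,\tau_R,\delta_R,\mu$ set $A_J=\begin{bmatrix}\tau_J&1\\ -\delta_J&0\end{bmatrix}$ and $f^J(x,y)=A_J\begin{bmatrix}x\\ y\end{bmatrix}+\begin{bmatrix}\mu\\ 0\end{bmatrix}$ for $J\in\{L,R\}$. The border-collision normal form is the continuous map of $\mathbb{R}^2$ equal to $f^L$ for $x\le0$ and $f^R$ for $x\ge0$; the switching manifold is $x=0$. A word $\mathcal{S}=\mathcal{S}_0\cdots\mathcal{S}_{n-1}$ on $\{L,R\}$ is primitive if it is not a power of a shorter word; primitive words are identified with periodic symbol sequences of minimal period $n$. $\mathcal{X}^k\mathcal{Y}$ denotes concatenation of $k$ copies of $\mathcal{X}$ followed by $\mathcal{Y}$. Put $f^{\mathcal{S}}=f^{\mathcal{S}_{n-1}}\circ\cdots\circ f^{\mathcal{S}_0}$, an affine map with matrix part $M_{\mathcal{S}}=A_{\mathcal{S}_{n-1}}\cdots A_{\mathcal{S}_0}$. An $\mathcal{S}$-cycle consists of points $(x_i^{\mathcal{S}},y_i^{\mathcal{S}})$, $i=0,\dots,n-1$, with $(x_0^{\mathcal{S}},y_0^{\mathcal{S}})$ a fixed point of $f^{\mathcal{S}}$ and $(x_{i+1}^{\mathcal{S}},y_{i+1}^{\mathcal{S}})=f^{\mathcal{S}_i}(x_i^{\mathcal{S}},y_i^{\mathcal{S}})$. It is unique if and only if $1$ is not an eigenvalue of $M_{\mathcal{S}}$. It is admissible if $x_i^{\mathcal{S}}\le0$ whenever $\mathcal{S}_i=L$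 and $x_i^{\mathcal{S}}\ge0$ whenever $\mathcal{S}_i=R$. It has no points on the switching manifold if $x_i^{\mathcal{S}}\neq0$ for all $i$. An admissible $\mathcal{S}$-cycle with no points on the switching manifold is stable if both eigenvalues of $M_{\mathcal{S}}$ have modulus $\le1$, and attracting if both have modulus $<1$. When the parameters depend on $\varepsilon$, so do all these objects. Let $\lambda_1(\varepsilon),\lambda_2(\varepsilon)$ be the eigenvalues of $M_{\mathcal{X}}(\varepsilon)$ (distinct and not equal to $1$ near $\varepsilon=0$ under the stated hypotheses, so the $\mathcal{X}$-cycle is unique), with corresponding eigenvectors $\zeta_1(\varepsilon),\zeta_2(\varepsilon)$ varying smoothly with $\varepsilon$, and $Q(\varepsilon)=[\zeta_1(\varepsilon),\zeta_2(\varepsilon)]$. In the coordinates $\begin{bmatrix}u\\ v\end{bmatrix}=Q^{-1}(\varepsilon)\left(\begin{bmatrix}x\\ y\end{bmatrix}-\begin{bmatrix}x_0^{\mathcal{X}}(\varepsilon)\\ y_0^{\mathcal{X}}(\varepsilon)\end{bmatrix}\right)$, the map $f^{\mathcal{X}}$ becomes $w\mapsto\mathrm{diag}(\lambda_1(\varepsilon),\lambda_2(\varepsilon))\,w$, and $f^{\mathcal{Y}}$ becomes $w\mapsto\begin{bmatrix}\gamma_{11}(\varepsilon)&\gamma_{12}(\varepsilon)\\ \gamma_{21}(\varepsilon)&\gamma_{22}(\varepsilon)\end{bmatrix}w+\begin{bmatrix}\sigma_1(\varepsilon)\\ \sigma_2(\varepsilon)\end{bmatrix}$, which defines $\gamma_{ij}$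 and $\sigma_i$. Primes denote $d/d\varepsilon$. *)

(* Defs.v *)
From HB Require Import structures.
From mathcomp Require Import all_boot all_order all_algebra.
From mathcomp Require Import complex.
From mathcomp Require Import all_classical all_reals all_analysis.

Set Implicit Arguments.
Unset Strict Implicit.
Unset Printing Implicit Defensive.

Import Order.TTheory GRing.Theory Num.Theory.
Import numFieldNormedType.Exports.

Local Open Scope classical_set_scope.
Local Open Scope ring_scope.

Inductive letter := Lft | Rgt.

Definition word := seq letter.

Definition wpow (w : word) (k : nat) : word := flatten (nseq k w).

Definition primitive (w : word) : Prop :=
  w <> [::] /\
  ~ exists (v : word) (m : nat), (size v < size w)%N /\ w = wpow v m.

Record params (R : realType) := Params {
  tauL : R; deltaL : R; tauR : R; deltaR : R; bmu : R }.

Section Bcnf.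
Context {R : realType}.
Implicit Types (p : params R) (J : letter) (S : word) (z : 'cV[R]_2).

Definition vec2 (x y : R) : 'cV[R]_2 := \col_i (if i == 0 then x else y).

Definition mat2 (a b c d : R) : 'M[R]_2 :=
  \matrix_(i, j) (if i == 0 then (if j == 0 then a else b)
                  else (if j == 0 then c else d)).

Definition xcoord z : R := z 0 0.

Definition Amx p J : 'M[R]_2 :=
  match J with
  | Lft => mat2 (tauL p) 1 (- deltaL p) 0
  | Rgt => mat2 (tauR p) 1 (- deltaR p) 0
  end.

Definition fletter p J z : 'cV[R]_2 := Amx p J *m z + vec2 (bmu p) 0.

(* The leftmost letter acts first. *)
Definition fword p S z : 'cV[R]_2 := foldl (fun z' J => fletter p J z') z S.

Definition Mword p S : 'M[R]_2 := foldl (fun M J => Amx p J *m M) 1%:M S.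

Definition unique_cycle p S : Prop := exists! z, fword p S z = z.

(* Meaningful when [f^S] has a fixed point; otherwise the junk value 0. *)
Definition cycle0 p S : 'cV[R]_2 := xget 0 [set z | fword p S z = z].

Definition cycle_pt p S (i : nat) : 'cV[R]_2 :=
  fword p (take i S) (cycle0 p S).

Definition cycle_x p S (i : nat) : R := xcoord (cycle_pt p S i).

Definition admissible p S : Prop :=
  forall i, (i < size S)%N ->
    match nth Lft S i with
    | Lft => cycle_x p S i <= 0
    | Rgt => 0 <= cycle_x p S i
    end.

Definition off_switching p S : Prop :=
  forall i, (i < size S)%N -> cycle_x p S i != 0.

(* For a nonempty word this is the minimum over [i < size S]: the default
   value of the big operator is the term of index 0. *)
Definition min_abs_x p S : R :=
  \big[Num.min/`|cycle_x p S 0|]_(i < size S) `|cycle_x p S i|.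

(* Eigenvalues are taken in the complex numbers [R[i]]. *)
Definition complex_eigenvalue (M : 'M[R]_2) (z : R[i]) : Prop :=
  eigenvalue (map_mx (real_complex R) M) z.

Definition stable p S : Prop :=
  [/\ admissible p S, off_switching p S &
      forall z : R[i], complex_eigenvalue (Mword p S) z -> `|z| <= 1].

Definition attracting p S : Prop :=
  [/\ admissible p S, off_switching p S &
      forall z : R[i], complex_eigenvalue (Mword p S) z -> `|z| < 1].

Definition smooth_near0 (f : R -> R) : Prop :=
  \forall e \near (0 : R), forall n : nat, derivable (derive1n n f) e 1.

Definition smooth_vec_near0 (f : R -> 'cV[R]_2) : Prop :=
  forall i, smooth_near0 (fun e => f e i 0).

Definition is_eigenpair (M : 'M[R]_2) (l : R) z : Prop :=
  z != 0 /\ M *m z = l *: z.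

Definition eigbasis z1 z2 : 'M[R]_2 := row_mx z1 z2.

Definition uvcoord (Q : 'M[R]_2) (z0 z : 'cV[R]_2) : 'cV[R]_2 :=
  invmx Q *m (z - z0).

End Bcnf.

(* Main.v *)
(** In eigencoordinates (u, v) of the X-cycle, f^X is diag(l1, l2) and f^Y is
    w |-> gamma w + sigma, so an S[k]-cycle is a fixed point of
    w |-> gamma diag(l1^k, l2^k) w + sigma, with trace g11 l1^k + g22 l2^k and
    determinant det gamma (l1 l2)^k.

    At e = 0, stability for infinitely many k bounds the trace, so g22 = 0. The
    points reached after k-1 and after k passes of X carry the different letters
    X_0 and Y_0, so their x-coordinates have opposite signs; comparing leading
    orders as k grows forces sigma_2 = 0 and then l1 l2 = 1: otherwise both points
    run off on the same side, or tend to the same point, which must have x = 0,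
    against (c). Uniqueness and stability then give -1 <= g12 g21 < 1.

    For 0 <= e <= D l2(0)^-k with D small and k large, e l2^k is small and
    k e -> 0, hence (l_i(e) / l_i(0))^j -> 1 uniformly in j <= k, and the cycle
    shadows a fixed homoclinic orbit, uniformly along its length. Every
    x-coordinate is therefore close to one at e = 0 for arbitrarily large k',
    from which it inherits sign (a) and size (c). The trace tends to 0 and the
    determinant to -g12 g21; if the latter is 1, the derivative hypothesis gives
    det <= (1 + C e)(1 - K e)^k < 1. *)

Require Import Defs.
From HB Require Import structures.
From mathcomp Require Import all_boot all_order all_algebra.
From mathcomp Require Import complex.
From mathcomp Require Import all_classical all_reals all_analysis.
From mathcomp Require Import zify ring lra.

Set Implicit Arguments.
Unset Strict Implicit.
Unset Printing Implicit Defensive.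

Import Order.TTheory GRing.Theory Num.Theory.
Import numFieldNormedType.Exports.

Local Open Scope classical_set_scope.
Local Open Scope ring_scope.

(** * Eigenvalues of real 2x2 matrices *)

Lemma char_poly_mx2 (F : comNzRingType) (A : 'M[F]_2) :
  char_poly A = 'X^2 - (\tr A) *: 'X + (\det A)%:P.
Proof.
apply/polyP => i; rewrite coefD coefB coefZ coefXn coefX coefC.
case: i => [|[|[|i]]] /=.
- by rewrite char_poly_det; ring.
- by rewrite (@char_poly_trace _ 2) //; ring.
- have := char_poly_monic A; rewrite monicE lead_coefE size_char_poly /=.
  by move=> /eqP ->; ring.
- by rewrite nth_default ?size_char_poly //; ring.
Qed.

Lemma complex_eigenvalue_mx2 (R : realType) (M : 'M[R]_2) (x y : R) :
  complex_eigenvalue M (x +i* y)%C <->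
  x ^+ 2 - y ^+ 2 - \tr M * x + \det M = 0 /\ (2 * x - \tr M) * y = 0.
Proof.
rewrite /complex_eigenvalue eigenvalue_root_char char_poly_mx2.
rewrite det_map_mx trace_map_mx /root !hornerE /=.
rewrite expr2 eq_complex /=.
split=> [/andP[/eqP a /eqP b]|[a b]].
  by split; [rewrite -[RHS]a|rewrite -[RHS]b]; ring.
by apply/andP; split; apply/eqP; [rewrite -[RHS]a|rewrite -[RHS]b]; ring.
Qed.

Lemma normc_le1 (R : realType) (x y : R) :
  (`|(x +i* y)%C| <= 1) = (x ^+ 2 + y ^+ 2 <= 1).
Proof.
rewrite normc_def lecR /=.
rewrite -[X in _ <= X]sqrtr1 ler_sqrt //.
Qed.

Lemma normc_lt1 (R : realType) (x y : R) :
  (`|(x +i* y)%C| < 1) = (x ^+ 2 + y ^+ 2 < 1).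
Proof.
rewrite normc_def ltcR /=.
rewrite -[X in _ < X]sqrtr1 ltr_sqrt //.
Qed.

(** The characteristic polynomial is positive at 1 and -1 and its vertex lies strictly between them,
    which confines any real root; a non-real pair has squared modulus equal to the determinant. *)
Lemma jury_strict (R : realType) (M : 'M[R]_2) (z : R[i]) :
  `|\tr M| < 1 + \det M -> \det M < 1 -> complex_eigenvalue M z -> `|z| < 1.
Proof.
case: z => x y; rewrite ltr_norml => /andP[T1 T2] d1.
move=> /complex_eigenvalue_mx2[e1 /eqP]; rewrite mulf_eq0 normc_lt1.
case/orP=> [/eqP e2|/eqP y0].
  have -> : x ^+ 2 + y ^+ 2 = \det M by nra.
  by [].
rewrite y0 !expr2 mulr0 in e1 *; rewrite addr0.
have x1 : x < 1.
  rewrite ltNge; apply/negP => x1.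
  suff : 0 < x ^+ 2 - \tr M * x + \det M by nra.
  nra.
have x2 : - 1 < x.
  rewrite ltNge; apply/negP => x2.
  suff : 0 < x ^+ 2 - \tr M * x + \det M by nra.
  nra.
nra.
Qed.

(** Both roots are written out from the discriminant, so the bound on all complex eigenvalues
    applies to each of them. *)
Lemma jury_weak (R : realType) (M : 'M[R]_2) :
  (forall z : R[i], complex_eigenvalue M z -> `|z| <= 1) ->
  `|\tr M| <= 1 + \det M /\ \det M <= 1.
Proof.
move=> H; set T := \tr M; set d := \det M.
have [disc|disc] := leP 0 (T ^+ 2 / 4 - d).
  set s := Num.sqrt (T ^+ 2 / 4 - d).
  have s0 : 0 <= s by exact: sqrtr_ge0.
  have ss : s * s = T ^+ 2 / 4 - d by rewrite -expr2 sqr_sqrtr.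
  have /H : complex_eigenvalue M ((T / 2 + s) +i* 0)%C.
    by apply/complex_eigenvalue_mx2; rewrite -/T -/d; split; nra.
  have /H : complex_eigenvalue M ((T / 2 - s) +i* 0)%C.
    by apply/complex_eigenvalue_mx2; rewrite -/T -/d; split; nra.
  rewrite !normc_le1 !expr2 !mulr0 !addr0 => h1 h2.
  have a1 : T / 2 + s <= 1 by nra.
  have a2 : - 1 <= T / 2 - s by nra.
  rewrite ler_norml; split; first by apply/andP; split; nra.
  nra.
set s := Num.sqrt (d - T ^+ 2 / 4).
have ss : s * s = d - T ^+ 2 / 4 by rewrite -expr2 sqr_sqrtr //; lra.
have /H : complex_eigenvalue M ((T / 2) +i* s)%C.
  by apply/complex_eigenvalue_mx2; rewrite -/T -/d; split; nra.
rewrite normc_le1 => h.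
have d1 : d <= 1 by nra.
rewrite ler_norml; split => //; apply/andP; split; nra.
Qed.

(** * Words and cycles *)

Section Words.
Context {R : realType}.
Implicit Types (p : params R) (S V W : word) (z : 'cV[R]_2).

Lemma fword_cat p V W z : fword p (V ++ W) z = fword p W (fword p V z).
Proof. exact: foldl_cat. Qed.

Lemma Mword_rcons p S J : Mword p (rcons S J) = Amx p J *m Mword p S.
Proof. by rewrite /Mword -cats1 foldl_cat. Qed.

Lemma fword_rcons p S J z : fword p (rcons S J) z = fletter p J (fword p S z).
Proof. by rewrite -cats1 fword_cat. Qed.

Lemma fword_affine p S z : fword p S z = Mword p S *m z + fword p S 0.
Proof.
elim/last_ind: S => [|S J IH]; first by rewrite /= mul1mx addr0.
by rewrite !fword_rcons Mword_rcons /fletter IH mulmxDr mulmxA addrA.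
Qed.

Lemma fword_sub p S z z' : fword p S z - fword p S z' = Mword p S *m (z - z').
Proof.
rewrite fword_affine [fword p S z']fword_affine mulmxBr.
by rewrite opprD addrACA subrr addr0.
Qed.

Lemma Mword_cat p V W : Mword p (V ++ W) = Mword p W *m Mword p V.
Proof.
elim/last_ind: W => [|W J IH]; first by rewrite cats0 mul1mx.
by rewrite -rcons_cat !Mword_rcons IH mulmxA.
Qed.

Lemma wpowS S k : wpow S k.+1 = S ++ wpow S k.
Proof. by []. Qed.

Lemma wpowD S j k : wpow S (j + k) = wpow S j ++ wpow S k.
Proof. by elim: j => // j IH; rewrite addSn !wpowS IH catA. Qed.

Lemma size_wpow S k : size (wpow S k) = (k * size S)%N.
Proof. by elim: k => // k IH; rewrite wpowS size_cat IH mulSn. Qed.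

(** A position in V^k W splits into a number of full passes of V and an offset. The full passes
    become diagonal in eigencoordinates, and only finitely many offsets remain. *)
Lemma take_block V W k j i : (j < k)%N -> (i < size V)%N ->
  take (j * size V + i) (wpow V k ++ W) = wpow V j ++ take i V.
Proof.
move=> jk iV; have -> : k = (j + (k - j).-1.+1)%N.
  by rewrite prednK ?subn_gt0 // subnKC // ltnW.
rewrite wpowD wpowS -!catA take_cat size_wpow ltnNge leq_addr /= addKn.
by rewrite takel_cat // ltnW.
Qed.

Lemma nth_block V W k j i : (j < k)%N -> (i < size V)%N ->
  nth Lft (wpow V k ++ W) (j * size V + i) = nth Lft V i.
Proof.
move=> jk iV; have -> : k = (j + (k - j).-1.+1)%N.
  by rewrite prednK ?subn_gt0 // subnKC // ltnW.
rewrite wpowD wpowS -!catA nth_cat size_wpow ltnNge leq_addr /= addKn.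
by rewrite nth_cat iV.
Qed.

Lemma take_tail V W k i : take (k * size V + i) (wpow V k ++ W) =
  wpow V k ++ take i W.
Proof. by rewrite take_cat size_wpow ltnNge leq_addr /= addKn. Qed.

Lemma nth_tail V W k i : nth Lft (wpow V k ++ W) (k * size V + i) = nth Lft W i.
Proof. by rewrite nth_cat size_wpow ltnNge leq_addr /= addKn. Qed.

Lemma index_cases V W k i : (i < size (wpow V k ++ W))%N ->
  (exists j m, [/\ (j < k)%N, (m < size V)%N & i = (j * size V + m)%N]) \/
  (exists2 m, (m < size W)%N & i = (k * size V + m)%N).
Proof.
rewrite size_cat size_wpow => iS.
have [ik|ki] := ltnP i (k * size V).
  have V0 : (0 < size V)%N by move: ik; case: (size V) => //; rewrite muln0.
  left; exists (i %/ size V)%N, (i %% size V)%N; split.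
  - by rewrite ltn_divLR.
  - by rewrite ltn_mod.
  - exact: divn_eq.
by right; exists (i - k * size V)%N; rewrite ?ltn_subLR ?subnKC.
Qed.

Lemma min_abs_x_le p S i : (i < size S)%N -> min_abs_x p S <= `|cycle_x p S i|.
Proof.
move=> iS; rewrite /min_abs_x (bigD1 (Ordinal iS)) //= ge_min.
by rewrite lexx.
Qed.

Lemma min_abs_x_ge0 p S : 0 <= min_abs_x p S.
Proof.
by rewrite /min_abs_x; elim/big_ind: _ => // x y x0 y0; rewrite le_min x0.
Qed.

Lemma fword_cycle0 p S :
  (exists z, fword p S z = z) -> fword p S (cycle0 p S) = cycle0 p S.
Proof. by move=> [z fz]; rewrite /cycle0; case: xgetP => [y _ //|/(_ z)]. Qed.

End Words.


(** * Explicit formulas for 2x2 matrices *)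

Section Mx2.
Context {F : fieldType}.
Implicit Types (A : 'M[F]_2).

Lemma big_ord2 (V : nmodType) (f : 'I_2 -> V) : \sum_i f i = f 0 + f 1.
Proof.
rewrite big_ord_recl big_ord1; congr (_ + f _); exact/val_inj.
Qed.

Lemma det_mx2 A : \det A = A 0 0 * A 1 1 - A 0 1 * A 1 0.
Proof.
rewrite (expand_det_row _ 0) big_ord2 /cofactor !det_mx11 !mxE /=.
rewrite !expr0 expr1 mul1r mulN1r mulrN.
by congr (_ * A _ _ - _ * A _ _); apply/val_inj.
Qed.

Lemma mxtrace2 A : \tr A = A 0 0 + A 1 1.
Proof. exact: big_ord2. Qed.

Lemma mul_mx2 m n (A : 'M[F]_(m, 2)) (B : 'M[F]_(2, n)) i j :
  (A *m B) i j = A i 0 * B 0 j + A i 1 * B 1 j.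
Proof. by rewrite mxE big_ord2. Qed.

Lemma det_1sub_mx2 A : \det (1%:M - A) = 1 - \tr A + \det A.
Proof. by rewrite !det_mx2 mxtrace2 !mxE /=; ring. Qed.

Lemma colP2 (z z' : 'cV[F]_2) : z 0 0 = z' 0 0 -> z 1 0 = z' 1 0 -> z = z'.
Proof.
move=> e0 e1; apply/colP => i; case: (unliftP ord0 i) => [j|] ->; last exact: e0.
by rewrite (_ : lift ord0 j = 1) //; apply/val_inj; rewrite /= ord1.
Qed.

End Mx2.

(** * Fixed points of the affine word maps *)

Section FixedPoints.
Context {R : realType}.
Implicit Types (p : params R) (S : word) (z : 'cV[R]_2).

Lemma unit_1sub_mx2 (M : 'M[R]_2) :
  (1%:M - M \in unitmx) = (1 - \tr M + \det M != 0).
Proof. by rewrite unitmxE det_1sub_mx2 unitfE. Qed.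

Lemma fixed_fword p S z : 1 - \tr (Mword p S) + \det (Mword p S) != 0 ->
  fword p S z = z <-> z = invmx (1%:M - Mword p S) *m fword p S 0.
Proof.
rewrite -unit_1sub_mx2 => Mu; rewrite fword_affine; split => [e|->].
  have -> : fword p S 0 = (1%:M - Mword p S) *m z.
    by rewrite mulmxBl mul1mx -[X in _ = X - _]e addrC addKr.
  by rewrite mulKmx.
set w := invmx _ *m _.
have : (1%:M - Mword p S) *m w = fword p S 0 by rewrite mulKVmx.
by rewrite mulmxBl mul1mx => <-; rewrite addrC subrK.
Qed.

(** The quantity is the characteristic polynomial at 1. When it vanishes, a kernel vector of 1 - M
    translates a fixed point to a second one. *)
Lemma unique_cycleP p S :
  unique_cycle p S <-> 1 - \tr (Mword p S) + \det (Mword p S) != 0.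
Proof.
split=> [[z [fz zu]]|D0]; last first.
  exists (invmx (1%:M - Mword p S) *m fword p S 0); split.
    exact/fixed_fword.
  by move=> z' /fixed_fword ->.
(* [det0P] gives a row vector in the left kernel, hence the passage to the transpose. *)
rewrite -unit_1sub_mx2 -unitmx_tr unitmxE unitfE; apply/negP => /det0P[v v0].
move=> /(congr1 trmx); rewrite trmx_mul trmxK trmx0 mulmxBl mul1mx => /eqP.
rewrite subr_eq0 => /eqP Mv.
suff : z = z + v^T.
  rewrite -{1}[z]addr0 => /addrI/(congr1 trmx).
  by rewrite trmxK trmx0 => /esym/eqP; rewrite (negbTE v0).
by apply: zu; rewrite -{2}fz [in RHS]fword_affine fword_affine mulmxDr -Mv addrAC.
Qed.

(** Replaces the choice in [cycle0] by a formula that can be differentiated in the parameter. *)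
Lemma cycle0E p S : 1 - \tr (Mword p S) + \det (Mword p S) != 0 ->
  cycle0 p S = invmx (1%:M - Mword p S) *m fword p S 0.
Proof.
move=> D0; apply/(fixed_fword _ D0)/fword_cycle0.
by have /unique_cycleP[z [fz _]] := D0; exists z.
Qed.

End FixedPoints.

(** * Eigencoordinates of the X-cycle *)

Section LocalCoordinates.
Context {R : realType}.
Variables (p : params R) (X Y : word) (z1 z2 : 'cV[R]_2) (l1 l2 : R)
  (G : 'M[R]_2) (s : 'cV[R]_2).
Hypothesis (E1 : is_eigenpair (Mword p X) l1 z1)
  (E2 : is_eigenpair (Mword p X) l2 z2).
Let Q := eigbasis z1 z2.
Let z0 := cycle0 p X.
Let uv := uvcoord Q z0.
Hypothesis (Qu : Q \in unitmx) (l1n1 : l1 != 1) (l2n1 : l2 != 1).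
Hypothesis HY : forall z, uv (fword p Y z) = G *m uv z + s.

Definition diag2 (a b : R) : 'M[R]_2 := mat2 a 0 0 b.

Lemma eigbasisE (w w' : 'cV[R]_2) i :
  eigbasis w w' i 0 = w i 0 /\ eigbasis w w' i 1 = w' i 0.
Proof.
rewrite /eigbasis; split.
  by rewrite -[RHS](row_mxEl w w'); congr (row_mx _ _ _ _); apply/val_inj.
by rewrite -[RHS](row_mxEr w w'); congr (row_mx _ _ _ _); apply/val_inj.
Qed.

Lemma eigbasis_mul (w w' a : 'cV[R]_2) :
  eigbasis w w' *m a = a 0 0 *: w + a 1 0 *: w'.
Proof.
apply/colP => i; rewrite mul_mx2.
by have [-> ->] := eigbasisE w w' i; rewrite mulrC [w' _ _ * _]mulrC !mxE.
Qed.

Lemma Mword_eigbasis : Mword p X *m Q = Q *m diag2 l1 l2.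
Proof.
have [_ e1] := E1; have [_ e2] := E2.
have {}e1 i : (Mword p X *m z1) i 0 = l1 * z1 i 0 by rewrite e1 mxE.
have {}e2 i : (Mword p X *m z2) i 0 = l2 * z2 i 0 by rewrite e2 mxE.
apply/matrixP => i j; rewrite !mul_mx2.
case: (unliftP ord0 j) => [k ->|->]; last first.
  rewrite /Q !(eigbasisE _ _ _).1 (eigbasisE _ _ _).2 !mxE /= mulr0 addr0.
  by rewrite [RHS]mulrC -e1 mul_mx2.
rewrite (_ : lift ord0 k = 1); last by apply/val_inj; rewrite /= ord1.
rewrite /Q !(eigbasisE _ _ _).2 (eigbasisE _ _ _).1 !mxE /= mulr0 add0r.
by rewrite [RHS]mulrC -e2 mul_mx2.
Qed.

Lemma uvK z : z = z0 + Q *m uv z.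
Proof. by rewrite /uv /uvcoord mulKVmx // addrC subrK. Qed.

Lemma uv_addQ w : uv (z0 + Q *m w) = w.
Proof. by rewrite /uv /uvcoord [z0 + _]addrC addrK mulKmx. Qed.

Lemma MwordX : Mword p X = Q *m diag2 l1 l2 *m invmx Q.
Proof. by rewrite -Mword_eigbasis mulmxK. Qed.

Lemma tr_diag2 a b : \tr (diag2 a b) = a + b.
Proof. by rewrite mxtrace2 !mxE. Qed.

Lemma det_diag2 a b : \det (diag2 a b) = a * b.
Proof. by rewrite det_mx2 !mxE /=; ring. Qed.

Lemma tr_conjmx (A B : 'M[R]_2) : A \in unitmx ->
  \tr (A *m B *m invmx A) = \tr B.
Proof. by move=> Au; rewrite mxtrace_mulC mulKmx. Qed.

Lemma det_conjmx (A B : 'M[R]_2) : A \in unitmx ->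
  \det (A *m B *m invmx A) = \det B.
Proof.
move=> Au; rewrite !det_mulmx mulrC mulrA -det_mulmx mulVmx // det1.
by rewrite mul1r.
Qed.

Lemma MwordX_nondeg : 1 - \tr (Mword p X) + \det (Mword p X) != 0.
Proof.
rewrite MwordX tr_conjmx // det_conjmx // tr_diag2 det_diag2.
have -> : 1 - (l1 + l2) + l1 * l2 = (1 - l1) * (1 - l2) by ring.
by rewrite mulf_neq0 // subr_eq0 eq_sym.
Qed.

Lemma fwordX_z0 : fword p X z0 = z0.
Proof.
by apply: fword_cycle0; have /unique_cycleP[z [fz _]] := MwordX_nondeg; exists z.
Qed.

Lemma fwordXk_z0 k : fword p (wpow X k) z0 = z0.
Proof. by elim: k => // k IH; rewrite wpowS fword_cat fwordX_z0. Qed.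

Lemma Mword_powX k : Mword p (wpow X k) = Q *m diag2 (l1 ^+ k) (l2 ^+ k) *m invmx Q.
Proof.
elim: k => [|k IH].
  rewrite /= /Mword /= (_ : diag2 _ _ = 1%:M) ?mulmx1 ?mulmxV //.
  apply/matrixP => i j; rewrite !mxE !expr0.
  by case: (unliftP ord0 i) => [i' ->|->]; case: (unliftP ord0 j) => [j' ->|->];
    rewrite // !ord1.
rewrite wpowS Mword_cat IH MwordX !mulmxA mulmxKV //.
congr (_ *m _); rewrite -mulmxA; congr (_ *m _).
apply/matrixP => i j; rewrite mul_mx2 !mxE /= !exprSr.
by case: (_ == _); case: (_ == _); rewrite ?mulr0 ?mul0r ?addr0 ?add0r.
Qed.

Lemma diag2_mul (a b : R) (w : 'cV[R]_2) :
  (diag2 a b *m w) 0 0 = a * w 0 0 /\ (diag2 a b *m w) 1 0 = b * w 1 0.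
Proof. by rewrite !mul_mx2 !mxE /= !mul0r addr0 add0r. Qed.

Lemma uv_powX k z :
  uv (fword p (wpow X k) z) = diag2 (l1 ^+ k) (l2 ^+ k) *m uv z.
Proof.
rewrite {2}/uv /uvcoord mulmxA.
have -> : diag2 (l1 ^+ k) (l2 ^+ k) *m invmx Q = invmx Q *m Mword p (wpow X k).
  by rewrite Mword_powX !mulmxA mulVmx // mul1mx.
by rewrite -mulmxA -fword_sub fwordXk_z0.
Qed.

Lemma xcoord_fword P z : xcoord (fword p P z) = xcoord (fword p P z0)
  + xcoord (Mword p P *m z1) * uv z 0 0 + xcoord (Mword p P *m z2) * uv z 1 0.
Proof.
have /eqP := fword_sub p P z z0; rewrite subr_eq => /eqP ->.
rewrite {1}(uvK z) [z0 + _]addrC addrK eigbasis_mul mulmxDr -!scalemxAr.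
by rewrite /xcoord !mxE; ring.
Qed.

(** The relation for f^Y is only pointwise. Subtracting its value at the X-cycle point, where the
    eigencoordinates vanish, isolates the linear part; basis vectors then give the matrix. *)
Lemma gammaE : G = invmx Q *m Mword p Y *m Q.
Proof.
have H (w : 'cV[R]_2) : G *m w = invmx Q *m Mword p Y *m Q *m w.
  have h1 := HY (z0 + Q *m w); have h2 := HY z0.
  have uz0 : uv z0 = 0 by rewrite /uv /uvcoord subrr mulmx0.
  rewrite uz0 mulmx0 add0r in h2; rewrite uv_addQ -h2 in h1.
  have -> : G *m w = uv (fword p Y (z0 + Q *m w)) - uv (fword p Y z0).
    by rewrite h1 addrK.
  rewrite /uv /uvcoord -mulmxBr opprB addrA subrK fword_sub.
  by rewrite [z0 + _]addrC addrK !mulmxA.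
apply/matrixP => i j; have := H (delta_mx j 0) => /matrixP/(_ i 0).
by rewrite -!colE !mxE.
Qed.

Lemma sigmaE : s = uv (fword p Y z0).
Proof. by rewrite HY /uv /uvcoord subrr !mulmx0 add0r. Qed.

Lemma tr_S k : \tr (Mword p (wpow X k ++ Y)) = G 0 0 * l1 ^+ k + G 1 1 * l2 ^+ k.
Proof.
rewrite Mword_cat Mword_powX mulmxA mxtrace_mulC !mulmxA -gammaE.
by rewrite mxtrace2 !mul_mx2 !mxE /=; ring.
Qed.

Lemma det_S k : \det (Mword p (wpow X k ++ Y)) =
  (G 0 0 * G 1 1 - G 0 1 * G 1 0) * (l1 * l2) ^+ k.
Proof.
rewrite Mword_cat det_mulmx Mword_powX det_conjmx // det_diag2 -exprMn.
have -> : \det (Mword p Y) = \det G; last by rewrite det_mx2.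
rewrite gammaE !det_mulmx mulrAC -det_mulmx mulVmx // det1 mul1r //.
Qed.

Lemma fixed_uv k z : fword p (wpow X k ++ Y) z = z ->
  uv z 0 0 = G 0 0 * (l1 ^+ k * uv z 0 0) + G 0 1 * (l2 ^+ k * uv z 1 0) + s 0 0
  /\ uv z 1 0 = G 1 0 * (l1 ^+ k * uv z 0 0) + G 1 1 * (l2 ^+ k * uv z 1 0) + s 1 0.
Proof.
rewrite fword_cat => /(congr1 uv); rewrite HY uv_powX => e.
have [d1 d2] := diag2_mul (l1 ^+ k) (l2 ^+ k) (uv z).
rewrite -d1 -d2; split; rewrite -[LHS]/(_ _ 0) -{1}e mxE mul_mx2 //.
Qed.

(** The number of passes enters only through the two powers: each prefix [P] of X or Y contributes
    one affine functional of the eigencoordinates, independent of k. *)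
Lemma xcoord_powX k P z : xcoord (fword p (wpow X k ++ P) z) =
  xcoord (fword p P z0) + xcoord (Mword p P *m z1) * (l1 ^+ k * uv z 0 0)
  + xcoord (Mword p P *m z2) * (l2 ^+ k * uv z 1 0).
Proof.
have [d1 d2] := diag2_mul (l1 ^+ k) (l2 ^+ k) (uv z).
by rewrite fword_cat xcoord_fword uv_powX d1 d2.
Qed.

End LocalCoordinates.

(** * Differentiability in the parameter *)

Section Derivability.
Context {R : realType}.
Implicit Types f g : R -> R.

Definition derivable_mx m n (M : R -> 'M[R]_(m, n)) (a : R) :=
  forall i j, derivable (fun e => M e i j) a 1.

Lemma derivable_mx_mul m n q (A : R -> 'M[R]_(m, n)) (B : R -> 'M[R]_(n, q)) a :
  derivable_mx A a -> derivable_mx B a -> derivable_mx (fun e => A e *m B e) a.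
Proof.
move=> dA dB i j.
rewrite (_ : (fun e => _) = \sum_k ((fun e => A e i k) * (fun e => B e k j))).
  by apply: derivable_sum => k; apply: derivableM.
by apply/funext => e; rewrite mxE fct_sumE.
Qed.

Lemma derivable_mx_add m n (A B : R -> 'M[R]_(m, n)) a :
  derivable_mx A a -> derivable_mx B a -> derivable_mx (fun e => A e + B e) a.
Proof.
move=> dA dB i j.
rewrite (_ : (fun e => _) = (fun e => A e i j) + (fun e => B e i j)).
  exact: derivableD.
by apply/funext => e; rewrite mxE.
Qed.

Lemma derivable_mx_opp m n (A : R -> 'M[R]_(m, n)) a :
  derivable_mx A a -> derivable_mx (fun e => - A e) a.
Proof.
move=> dA i j; rewrite (_ : (fun e => _) = - (fun e => A e i j)).
  exact: derivableN.
by apply/funext => e; rewrite mxE.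
Qed.

Lemma derivable_mx_cst m n (A : 'M[R]_(m, n)) a : derivable_mx (fun=> A) a.
Proof. by move=> i j; exact: derivable_cst. Qed.

Lemma derivable_det2 (A : R -> 'M[R]_2) a :
  derivable_mx A a -> derivable (fun e => \det (A e)) a 1.
Proof.
move=> dA.
rewrite (_ : (fun e => _) = (fun e => A e 0 0) * (fun e => A e 1 1)
   - (fun e => A e 0 1) * (fun e => A e 1 0)).
  by apply: derivableB; apply: derivableM.
by apply/funext => e; rewrite det_mx2.
Qed.

Lemma derivable_eigbasis (A B : R -> 'cV[R]_2) a :
  derivable_mx A a -> derivable_mx B a ->
  derivable_mx (fun e => eigbasis (A e) (B e)) a.
Proof.
move=> dA dB i j; case: (unliftP ord0 j) => [k ->|->].
  rewrite (_ : lift ord0 k = 1); last by apply/val_inj; rewrite /= ord1.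
  rewrite (_ : (fun e => _) = (fun e => B e i 0)) //.
  by apply/funext => e; rewrite (eigbasisE _ _ _).2.
rewrite (_ : (fun e => _) = (fun e => A e i 0)) //.
by apply/funext => e; rewrite (eigbasisE _ _ _).1.
Qed.

Lemma adj_mx2 (A : 'M[R]_2) : \adj A = mat2 (A 1 1) (- A 0 1) (- A 1 0) (A 0 0).
Proof.
apply/matrixP => i j; rewrite !mxE /cofactor det_mx11 !mxE.
case: (unliftP ord0 i) => [i' ->|->]; case: (unliftP ord0 j) => [j' ->|->];
  rewrite ?ord1 /= ?expr0 ?expr1 ?mul1r ?mulN1r ?sqrrN ?expr2 ?mulN1r ?opprK ?mul1r.
all: try congr (- _); congr (A _ _); exact/val_inj.
Qed.

(** Adjugate over determinant is the inverse only where the determinant is nonzero, which by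
    continuity holds near [a]; this suffices for a derivative at [a]. *)
Lemma derivable_mx_inv (A : R -> 'M[R]_2) a :
  derivable_mx A a -> A a \in unitmx -> derivable_mx (fun e => invmx (A e)) a.
Proof.
move=> dA Au; have dd := derivable_det2 dA.
have d0 : \det (A a) != 0 by rewrite -unitfE -unitmxE.
have near0 : \forall e \near a, \det (A e) != 0.
  have /differentiable_continuous cd : differentiable (fun e => \det (A e)) a.
    exact/derivable1_diffP.
  exact: cvgr_neq0 cd d0.
move=> i j.
pose F e := (\det (A e))^-1 * (\adj (A e)) i j.
apply: (@near_eq_derivable _ _ _ F); last first.
  apply: derivableM; first exact: derivableV.
  rewrite (_ : (fun e => _) = (fun e =>
     mat2 (A e 1 1) (- A e 0 1) (- A e 1 0) (A e 0 0) i j)); last first.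
    by apply/funext => e; rewrite adj_mx2.
  under eq_fun do rewrite mxE.
  by case: (i == 0); case: (j == 0); [exact: dA|apply: derivableN; exact: dA..|exact: dA].
near=> e; have de : \det (A e) != 0 by near: e.
by rewrite /F /invmx unitmxE unitfE de [RHS]mxE.
Unshelve. all: by end_near. Qed.

End Derivability.

(** * Dependence of words and cycles on the parameter *)

Section DerivableMap.
Context {R : realType}.
Variables (mu : R) (tL dL tR dR : R -> R) (a : R).
Hypothesis (dtL : derivable tL a 1) (ddL : derivable dL a 1)
  (dtR : derivable tR a 1) (ddR : derivable dR a 1).
Let p := fun e : R => Params (tL e) (dL e) (tR e) (dR e) mu.

Lemma derivable_Amx J : derivable_mx (fun e => Amx (p e) J) a.
Proof.
move=> i j; case: J; under eq_fun do rewrite mxE; case: (i == 0); case: (j == 0).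
- exact: dtL.
- exact: derivable_cst.
- by apply: derivableN; exact: ddL.
- exact: derivable_cst.
- exact: dtR.
- exact: derivable_cst.
- by apply: derivableN; exact: ddR.
- exact: derivable_cst.
Qed.

Lemma derivable_Mword S : derivable_mx (fun e => Mword (p e) S) a.
Proof.
elim/last_ind: S => [|S J IH]; first exact: derivable_mx_cst.
under eq_fun do rewrite Mword_rcons.
by apply: derivable_mx_mul => //; exact: derivable_Amx.
Qed.

Lemma derivable_fword S (z : R -> 'cV[R]_2) :
  derivable_mx z a -> derivable_mx (fun e => fword (p e) S (z e)) a.
Proof.
move=> dz; elim/last_ind: S => [//|S J IH].
under eq_fun do rewrite fword_rcons /fletter.
apply: (@derivable_mx_add _ _ _ (fun e => Amx (p e) J *m fword (p e) S (z e))
  (fun=> vec2 mu 0)); last exact: derivable_mx_cst.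
by apply: derivable_mx_mul => //; exact: derivable_Amx.
Qed.

Lemma near_cycle_nondeg S : 1 - \tr (Mword (p a) S) + \det (Mword (p a) S) != 0 ->
  \forall e \near a, 1 - \tr (Mword (p e) S) + \det (Mword (p e) S) != 0.
Proof.
rewrite -det_1sub_mx2 => d0.
have /derivable_det2 dd : derivable_mx (fun e => 1%:M - Mword (p e) S) a.
  apply: (@derivable_mx_add _ _ _ (fun=> 1%:M)); first exact: derivable_mx_cst.
  exact/derivable_mx_opp/derivable_Mword.
have /differentiable_continuous cd :
    differentiable (fun e => \det (1%:M - Mword (p e) S)) a.
  exact/derivable1_diffP.
have : \forall e \near a, \det (1%:M - Mword (p e) S) != 0.
  exact: cvgr_neq0 cd d0.
by apply: filterS => e; rewrite det_1sub_mx2.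
Qed.

Lemma derivable_cycle0 S : 1 - \tr (Mword (p a) S) + \det (Mword (p a) S) != 0 ->
  derivable_mx (fun e => cycle0 (p e) S) a.
Proof.
move=> d0 i j.
apply: (@near_eq_derivable _ _ _
  (fun e => (invmx (1%:M - Mword (p e) S) *m fword (p e) S 0) i j)).
  have nd := near_cycle_nondeg d0.
  by near=> e; rewrite cycle0E //; near: e.
apply: derivable_mx_mul; last exact/derivable_fword/derivable_mx_cst.
apply: (@derivable_mx_inv _ (fun e => 1%:M - Mword (p e) S)).
  2: by rewrite unit_1sub_mx2.
apply: (@derivable_mx_add _ _ _ (fun=> 1%:M)); first exact: derivable_mx_cst.
exact/derivable_mx_opp/derivable_Mword.
Unshelve. all: by end_near. Qed.

End DerivableMap.

(** Smoothness is assumed of the eigenvectors; the eigenvalue is recovered as the quotient of a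
    component of M z by the same component of z, chosen nonzero at [a]. *)
Lemma derivable_eigenvalue (R : realType) (M : R -> 'M[R]_2)
  (z : R -> 'cV[R]_2) (l : R -> R) (a : R) :
  derivable_mx M a -> derivable_mx z a ->
  (\forall e \near a, is_eigenpair (M e) (l e) (z e)) -> derivable l a 1.
Proof.
move=> dM dz H; have [z0 _] := nbhs_singleton H.
have [i zi] : exists i, z a i 0 != 0.
  apply/existsP; apply: contra_neqT z0 => /existsPn z0.
  by apply/colP => i; rewrite mxE; apply/eqP/negbNE/z0.
have near0 : \forall e \near a, z e i 0 != 0.
  have /differentiable_continuous cd : differentiable (fun e => z e i 0) a.
    exact/derivable1_diffP.
  exact: cvgr_neq0 cd zi.
apply: (@near_eq_derivable _ _ _ (fun e => (M e *m z e) i 0 * (z e i 0)^-1)).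
  near=> e.
  have [_ ->] : is_eigenpair (M e) (l e) (z e) by near: e.
  by rewrite mxE mulfK //; near: e.
apply: derivableM; first exact: derivable_mx_mul.
exact: derivableV.
Unshelve. all: by end_near. Qed.

Lemma smooth_near0_derivable (R : realType) (f : R -> R) :
  smooth_near0 f -> derivable f 0 1.
Proof. by move=> /nbhs_singleton /(_ 0%N). Qed.

Lemma derivable_lipschitz (R : realType) (f : R -> R) (a : R) :
  derivable f a 1 ->
  exists2 C, 0 < C & \forall e \near a, `|f e - f a| <= C * `|e - a|.
Proof.
move=> df; set l := 'D_1 f a.
have C0 : 0 < `|l| + 1 by rewrite ltr_wpDl.
exists (`|l| + 1) => //.
have : \forall h \near 0^', `|h^-1 *: (f (h *: 1 + a) - f a)| <= `|l| + 1.
  have : h^-1 *: ((f \o shift a) (h *: 1) - f a) @[h --> 0^'] --> l by exact: df.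
  move=> /cvgr_norm_le; apply; rewrite ltrDl //.
rewrite near_withinE => /nbhs_ballP[d /= d0 H].
near=> e.
have [->|ea] := eqVneq e a; first by rewrite !subrr normr0 mulr0.
have h0 : e - a != 0 by rewrite subr_eq0.
have : `|(e - a)^-1 *: (f ((e - a) *: 1 + a) - f a)| <= `|l| + 1.
  apply: H => //; rewrite /ball /= sub0r normrN distrC.
  by near: e; exact: (nbhsx_ballx a d d0).
rewrite [(e - a) *: 1]mulr1 subrK normrZ normfV mulrC ler_pdivrMr ?normr_gt0 //.
Unshelve. all: by end_near. Qed.

(** The quadratic term is what makes k L^-k tend to 0. *)
Lemma bernoulli2 (R : realFieldType) (h : R) k : 0 <= h ->
  1 + k%:R * h + k%:R * (k%:R - 1) / 2 * h ^+ 2 <= (1 + h) ^+ k.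
Proof.
move=> h0; elim: k => [|k IH]; first by rewrite expr0 !mul0r !addr0.
rewrite -natr1.
have h1 : 0 <= 1 + h by rewrite addr_ge0.
rewrite [X in _ <= X]exprS. apply: le_trans (ler_wpM2l h1 IH).
have k0 : 0 <= k%:R :> R by [].
(* The cubic term left over when the product is expanded; it is dropped. *)
have kk : 0 <= k%:R * (k%:R - 1) / 2 * h ^+ 3 :> R.
  rewrite mulr_ge0 ?exprn_ge0 // divr_ge0 //.
  by case: k {IH k0} => [|k]; rewrite ?mul0r // -natr1 addrK mulr_ge0.
set K := k%:R in k0 kk *; rewrite !exprS expr0 in kk *.
lra.
Qed.

(** * Asymptotics for parameters of order L^-k *)

Section HomoclinicFilter.
Context {R : realType}.
Variable L : R.
Hypothesis L1 : 1 < L.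

(* A triple is (number k of passes of X, parameter e, pass index j). *)
Definition homoclinic : set_system (nat * R * nat) :=
  [set P | exists D k0, 0 < D /\ forall k e j, (k0 <= k)%N -> 0 <= e ->
     e <= D * L ^- k -> (j <= k)%N -> P (k, e, j)].

Let L0 : 0 < L. Proof. exact: lt_trans L1. Qed.

(** Convergence along this filter is uniform in [e] and [j], so estimates on a whole cycle become
    limit computations. It is proper because e = 0 and j = 0 are always allowed. *)
#[export] Instance homoclinic_proper : ProperFilter homoclinic.
Proof.
split.
  move=> [D [k0 [D0 /(_ k0 0 0%N)]]]; apply => //.
  by rewrite mulr_ge0 ?ltW // invr_gt0 exprn_gt0.
split.
- by exists 1, 0%N; split.
- move=> P P' [D [k0 [D0 H]]] [D' [k0' [D0' H']]].
  exists (Num.min D D'), (maxn k0 k0'); split; first by rewrite lt_min D0.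
  move=> k e j; rewrite geq_max => /andP[k1 k2] e0 eD jk.
  have Lk : 0 <= L ^- k by rewrite ltW // invr_gt0 exprn_gt0.
  split; [apply: H => //|apply: H' => //]; apply: (le_trans eD);
    by rewrite ler_wpM2r // ge_min lexx ?orbT.
- move=> P P' PP' [D [k0 [D0 H]]]; exists D, k0; split=> // k e j *.
  by apply: PP'; exact: H.
Qed.

Lemma homoclinic_k : (fun t : nat * R * nat => t.1.1) @ homoclinic --> \oo.
Proof.
move=> P [N _ NP]; exists 1, N; split=> // k e j Nk *; exact: NP.
Qed.

Lemma homoclinic_le P :
  (exists D k0, 0 < D /\ forall k e j, (k0 <= k)%N -> 0 <= e ->
     e * L ^+ k <= D -> (j <= k)%N -> P (k, e, j)) -> homoclinic P.
Proof.
move=> [D [k0 [D0 H]]]; exists D, k0; split=> // k e j k0k e0 eD jk.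
by apply: H => //; rewrite -ler_pdivlMr ?exprn_gt0.
Qed.

Lemma homoclinic_eL : (fun t => t.1.2 * L ^+ t.1.1) @ homoclinic --> 0.
Proof.
apply/cvgrPdist_le => d d0; apply: homoclinic_le.
exists d, 0%N; split=> // k e j _ e0 eD _ /=.
by rewrite sub0r normrN ger0_norm // mulr_ge0 // exprn_ge0 // ltW.
Qed.

Lemma homoclinic_e : (fun t => t.1.2) @ homoclinic --> (0 : R).
Proof.
apply/cvgrPdist_le => d d0; apply: homoclinic_le.
exists d, 0%N; split=> // k e j _ e0 eD _ /=.
rewrite sub0r normrN ger0_norm //; apply: le_trans eD.
by rewrite ler_peMr // exprn_ege1 // ltW.
Qed.

Lemma homoclinic_ke : (fun t => t.1.1%:R * t.1.2) @ homoclinic --> (0 : R).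
Proof.
have kL : (fun k : nat => k%:R * L ^- k) @ \oo --> (0 : R).
  set h := L - 1; have h0 : 0 < h by rewrite subr_gt0.
  have LE : L = 1 + h by rewrite addrC subrK.
  apply/cvgrPdist_le => d d0; near=> k.
  have k1 : 1 <= k%:R :> R by rewrite ler1n; near: k; exists 1%N.
  rewrite sub0r normrN ger0_norm.
    2: by rewrite mulr_ge0 // invr_ge0 exprn_ge0 // ltW.
  rewrite ler_pdivrMr ?exprn_gt0 //.
  have := @bernoulli2 _ h k (ltW h0); rewrite -LE => B.
  (* The threshold at which k is at most d times the quadratic Bernoulli term. *)
  have kd : 2 / (d * h ^+ 2) + 1 <= k%:R :> R.
    by near: k; exact: nbhs_infty_ger.
  have dh : 0 < d * h ^+ 2 by rewrite mulr_gt0 // exprn_gt0.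
  have {}kd : 2 <= (k%:R - 1) * (d * h ^+ 2).
    by rewrite -ler_pdivrMr // lerBrDr.
  have : k%:R * 2 <= k%:R * ((k%:R - 1) * (d * h ^+ 2)).
    by rewrite ler_wpM2l.
  have kh : 0 <= d * (k%:R * h) by rewrite !mulr_ge0 // ltW.
  have := ler_wpM2l (ltW d0) B; lra.
rewrite (_ : (fun t => _) = (fun t : nat * R * nat =>
   (t.1.1%:R * L ^- t.1.1) * (t.1.2 * L ^+ t.1.1))); last first.
  apply/funext => t; rewrite mulrACA [L ^- _ * _]mulrC mulfV ?mulr1 //.
  by rewrite expf_neq0 // gt_eqF.
rewrite -[X in _ --> X](mul0r (0 : R)); apply: cvgM; last exact: homoclinic_eL.
exact: cvg_comp homoclinic_k kL.
Unshelve. all: by end_near. Qed.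

Lemma homoclinic_derivable (f : R -> R) : derivable f 0 1 ->
  (fun t => f t.1.2) @ homoclinic --> f 0.
Proof.
move=> /derivable1_diffP/differentiable_continuous cf.
exact: cvg_comp homoclinic_e cf.
Qed.

Lemma homoclinic_near (P : R -> Prop) : (\forall e \near 0, P e) ->
  \forall t \near homoclinic, P t.1.2.
Proof. by move=> nP; exact: homoclinic_e nP. Qed.

(** A function vanishing at 0 is O(e), and e L^k is small on this scale. It will control [g22] and
    [s2], which are multiplied by growing powers of the unstable eigenvalue. *)
Lemma homoclinic_fL (f : R -> R) : derivable f 0 1 -> f 0 = 0 ->
  (fun t => f t.1.2 * L ^+ t.1.1) @ homoclinic --> 0.
Proof.
move=> /derivable_lipschitz[C C0 Cf] f0.
have := cvgMl_tmp (a := C) homoclinic_eL; rewrite mulr0 => /(_ _) H.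
have Hn : (fun t : nat * R * nat => - (C * (t.1.2 * L ^+ t.1.1))) @ homoclinic --> 0.
  by have := cvgN H; rewrite oppr0; apply.
apply: (squeeze_cvgr _ Hn H).
have := homoclinic_near Cf.
apply: filter_app; exists 1, 0%N; split=> // k e j _ e0 _ _ /=.
rewrite f0 !subr0 (ger0_norm e0) => fe; rewrite -ler_norml normrM mulrA.
have Lk : 0 <= L ^+ k by rewrite exprn_ge0 // ltW.
by rewrite (ger0_norm Lk) ler_wpM2r.
Qed.

(** Since |r(e) - 1| <= C e, the power differs from 1 by at most (1 + C e)^m - 1 <= exp(k e C) - 1,
    and k e tends to 0. The bound depends on k alone, hence the uniformity in the exponent. *)
Lemma homoclinic_pow (r : R -> R) (n : nat * R * nat -> nat) :
  (\forall t \near homoclinic, (n t <= t.1.1)%N) ->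
  derivable r 0 1 -> r 0 = 1 ->
  (fun t => r t.1.2 ^+ n t) @ homoclinic --> (1 : R).
Proof.
move=> nk /derivable_lipschitz[C C0 Cr] r0.
have H : (fun t : nat * R * nat => expR (t.1.1%:R * t.1.2 * C)) @ homoclinic --> (1 : R).
  have h0 : (fun t : nat * R * nat => t.1.1%:R * t.1.2 * C) @ homoclinic --> (0 : R).
    by rewrite -(mul0r C); exact: cvgMr_tmp homoclinic_ke.
  by have := cvg_comp _ _ h0 (@continuous_expR R 0); rewrite expR0.
have Hl : (fun t : nat * R * nat =>
   1 - (expR (t.1.1%:R * t.1.2 * C) - 1)) @ homoclinic --> (1 : R).
  have c1 : (fun=> 1 : R) @ homoclinic --> (1 : R) by exact: cvg_cst.
  have := cvgB c1 (cvgB H c1).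
  rewrite subrr subr0; exact.
apply: (squeeze_cvgr _ Hl H).
have := homoclinic_near Cr; apply: filter_app; move: nk.
apply: filter_app; exists 1, 0%N; split=> // k e j _ e0 _ _ /=.
rewrite r0 subr0 (ger0_norm e0); set m := n _ => mk re.
have ce : 0 <= C * e by rewrite mulr_ge0 // ltW //.
have pw : `|r e ^+ m - 1| <= (1 + C * e) ^+ m - 1.
  elim: m {mk} => [|m IH]; first by rewrite !expr0 subrr normr0.
  have -> : r e ^+ m.+1 - 1 = (r e ^+ m - 1) * r e + (r e - 1) by rewrite exprSr; ring.
  apply: (le_trans (ler_normD _ _)); rewrite normrM exprSr.
  have re1 : `|r e| <= 1 + C * e.
    by rewrite -{1}(subrK 1 (r e)) addrC (le_trans (ler_normD _ _)) // normr1 lerD2l.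
  have := ler_pM (normr_ge0 _) (normr_ge0 _) IH re1.
  lra.
have ex : (1 + C * e) ^+ m <= expR (k%:R * e * C).
  have e1 : (1 + C * e) ^+ m <= (1 + C * e) ^+ k.
    by rewrite ler_weXn2l // lerDl.
  apply: (le_trans e1); rewrite -mulrA expRM_natl [e * C]mulrC lerXn2r ?nnegrE //.
  - by rewrite addr_ge0.
  - exact: expR_ge1Dx.
have := le_trans pw (lerB ex (lexx 1)); rewrite ler_norml => /andP[h1 h2].
apply/andP; split; lra.
Qed.

End HomoclinicFilter.

Lemma cvg_affine3 (R : realType) (T : Type) (F : set_system T) {FF : Filter F}
    (f1 f2 f3 g : T -> R) (a a1 a2 a3 : R) :
  f1 @ F --> (0 : R) -> f2 @ F --> (0 : R) -> f3 @ F --> (0 : R) ->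
  (forall t, g t = a + a1 * f1 t + a2 * f2 t + a3 * f3 t) -> g @ F --> a.
Proof.
move=> c1 c2 c3 gE; have ca : (fun=> a) @ F --> a by exact: cvg_cst.
rewrite (funext gE).
have := cvgD (cvgD (cvgD ca (cvgMl_tmp (a := a1) c1)) (cvgMl_tmp (a := a2) c2))
  (cvgMl_tmp (a := a3) c3).
by rewrite !mulr0 !addr0; apply.
Qed.

(** * Relations at the critical parameter *)

Section CriticalRelations.
Context {R : realType}.
Variables (g11 g12 g21 g22 s1 s2 l1 l2 x0 p q : R).

(** [trk] and [detk] are the trace and determinant of the matrix of S[k] in eigencoordinates. *)
Definition trk k := g11 * l1 ^+ k + g22 * l2 ^+ k.
Definition detk k := (g11 * g22 - g12 * g21) * (l1 * l2) ^+ k.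
(* Here and below, (u, v) are the eigencoordinates of the first cycle point. *)
Definition fixk k u v :=
  u = g11 * (l1 ^+ k * u) + g12 * (l2 ^+ k * v) + s1 /\
  v = g21 * (l1 ^+ k * u) + g22 * (l2 ^+ k * v) + s2.
(* x0, p and q are the coefficients of an affine coordinate in (u, v). *)
Definition xk j u v := x0 + p * (l1 ^+ j * u) + q * (l2 ^+ j * v).

Variables (K : set nat) (m : nat -> R).
Hypotheses (l1_ge0 : 0 <= l1) (l1_lt1 : l1 < 1) (l2_gt1 : 1 < l2) (q0 : q != 0).
Hypothesis Kinf : forall N, exists2 k, (N <= k)%N & K k.
(** Membership of k in [K] concerns the word with k+1 passes, so that the points after k and after
    k+1 passes both belong to the cycle. *)
Hypothesis HK : forall k, K k -> [/\ exists u v, fixk k.+1 u v /\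
    xk k.+1 u v * xk k u v <= 0,
  `|trk k.+1| <= 1 + detk k.+1, detk k.+1 <= 1 &
  1 - trk k.+1 + detk k.+1 != 0].
(** [m] abstracts the distance of the cycle to the switching manifold; it is compared with the point
    after the last pass when the cycle is unique. *)
Hypothesis m_ge0 : forall k, 0 <= m k.
Hypothesis m_not0 : ~ m @ \oo --> (0 : R).
Hypothesis Hm : forall k, 1 - trk k + detk k != 0 -> exists u v, fixk k u v /\
  m k <= `|xk k u v|.

Lemma often_near (P : nat -> Prop) : (\forall k \near \oo, P k) -> exists2 k, K k & P k.
Proof.
by move=> [N _ NP]; have [k Nk Kk] := Kinf N; exists k => //; exact: NP.
Qed.

Let l2_gt0 : 0 < l2. Proof. exact: lt_trans l2_gt1. Qed.
Let w := l2^-1.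
Let w_gt0 : 0 < w. Proof. by rewrite invr_gt0. Qed.
Let w_lt1 : w < 1. Proof. by rewrite invf_lt1. Qed.
Let l2w k : l2 ^+ k * w ^+ k = 1.
Proof. by rewrite -exprMn mulfV ?expr1n // gt_eqF. Qed.

Lemma expr_cvg0 (z : R) : 0 <= z -> z < 1 -> (fun k => z ^+ k) @ \oo --> (0 : R).
Proof. by move=> z0 z1; apply: cvg_expr; rewrite ger0_norm. Qed.

Lemma expr_cvg0S (z : R) : 0 <= z -> z < 1 -> (fun k => z ^+ k.+1) @ \oo --> (0 : R).
Proof. by move=> z0 z1; rewrite (cvg_shiftS (fun k => z ^+ k)); exact: expr_cvg0. Qed.

Lemma detk_ge k : K k -> - 1 <= detk k.+1.
Proof. by case/HK=> _; rewrite ler_norml => /andP[a b] c _; lra. Qed.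

(** Stability bounds the trace by 2, so |g22| l2^(k+1) <= 2 + |g11| for arbitrarily large k. *)
Lemma g22_eq0 : g22 = 0.
Proof.
apply/eqP/negP => /negP g0.
have : (fun k => w ^+ k.+1 * (2 + `|g11|)) @ \oo --> 0 * (2 + `|g11|).
  apply: cvgMr_tmp; apply: expr_cvg0S => //; exact: ltW.
rewrite mul0r => /cvgr_lt /(_ `|g22|); rewrite normr_gt0 => /(_ g0).
move=> /often_near[k Kk]; have [_ tk dk _] := HK Kk; apply/negP; rewrite -leNgt.
rewrite mulrC -[w ^+ _]invrK -/w /w exprVn invrK ler_pdivlMr ?exprn_gt0 //.
have -> : `|g22| * l2 ^+ k.+1 = `|trk k.+1 - g11 * l1 ^+ k.+1|.
  rewrite /trk addrC addKr normrM; congr (_ * _).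
  by rewrite ger0_norm // exprn_ge0 // ltW.
apply: (le_trans (ler_normB _ _)); apply: lerD; first by apply: (le_trans tk); lra.
rewrite normrM (ger0_norm (exprn_ge0 _ l1_ge0)) ler_piMr //.
by apply: exprn_ile1 => //; exact: ltW.
Qed.

Let c := g12 * g21.
Let rho := l1 * l2.
Let Dk k := 1 - g11 * l1 ^+ k - c * rho ^+ k.

Lemma DkE k : 1 - trk k + detk k = Dk k.
Proof. by rewrite /trk /detk /Dk /c /rho g22_eq0; ring. Qed.

Lemma fixk_solved k u v : fixk k u v ->
  Dk k * u = g12 * l2 ^+ k * s2 + s1 /\
  Dk k * v = g21 * l1 ^+ k * s1 + s2 * (1 - g11 * l1 ^+ k).
Proof.
rewrite /fixk g22_eq0 mul0r addr0 => -[]; rewrite /Dk /rho exprMn /c.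
set a := l1 ^+ k; set b := l2 ^+ k => /eqP; rewrite -subr_eq0 => /eqP eu.
move=> /eqP; rewrite -subr_eq0 => /eqP ev.
set X := u - _ in eu; set Y := v - _ in ev.
split; apply/eqP; rewrite -subr_eq0; apply/eqP.
  (* [X] and [Y] are the residuals of the two equations, both 0; weighting them by cofactors
     eliminates the other unknown. *)
  transitivity (X + Y * (g12 * b)); first by rewrite /X /Y; ring.
  by rewrite eu ev mul0r addr0.
transitivity (Y * (1 - g11 * a) + X * (g21 * a)); first by rewrite /X /Y; ring.
by rewrite eu ev !mul0r addr0.
Qed.

Lemma xk_end k u v : fixk k u v -> Dk k * xk k u v =
  x0 * Dk k + p * (g12 * rho ^+ k * s2 + l1 ^+ k * s1)
  + q * (l2 ^+ k * s2 + rho ^+ k * (g21 * s1 - g11 * s2)).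
Proof.
move=> /fixk_solved[eu ev]; rewrite /xk.
transitivity (x0 * Dk k + p * l1 ^+ k * (Dk k * u)
  + q * l2 ^+ k * (Dk k * v)); first by ring.
by rewrite eu ev /rho exprMn; ring.
Qed.

(** The same cycle one pass earlier than in [xk_end] at k+1: the part multiplied by [q] is divided
    by l2, so it keeps its sign. This is what puts both points on one side. *)
Lemma xk_pre k u v : fixk k.+1 u v -> Dk k.+1 * xk k u v =
  x0 * Dk k.+1 + p * (g12 * l2 * rho ^+ k * s2 + l1 ^+ k * s1)
  + q * (l2 ^+ k * s2 + l1 * rho ^+ k * (g21 * s1 - g11 * s2)).
Proof.
move=> /fixk_solved[eu ev]; rewrite /xk.
transitivity (x0 * Dk k.+1 + p * l1 ^+ k * (Dk k.+1 * u)
  + q * l2 ^+ k * (Dk k.+1 * v)); first by ring.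
by rewrite eu ev /rho exprMn !exprS; ring.
Qed.

(* The factor r rescales both coordinates of a cycle so that they converge;
   multiplying by Dk avoids dividing by a quantity that may vanish. *)
Lemma opposite_limits (A B : nat -> R) (a b : R) :
  (forall k u v, K k -> fixk k.+1 u v ->
    exists r, A k = r * (Dk k.+1 * xk k.+1 u v) /\ B k = r * (Dk k.+1 * xk k u v)) ->
  A @ \oo --> a -> B @ \oo --> b -> a * b <= 0.
Proof.
move=> H cA cB; rewrite leNgt; apply/negP => ab.
have cAB : (fun k => A k * B k) @ \oo --> a * b by exact: cvgM.
have /often_near[k Kk] : \forall k \near \oo, 0 < A k * B k by exact: cvgr_gt cAB _ ab.
have [[u [v [fk xx]]] _ _ _] := HK Kk.
have [r [Ar Br]] := H _ _ _ Kk fk; rewrite /= Ar Br; apply/negP; rewrite -leNgt.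
have -> : r * (Dk k.+1 * xk k.+1 u v) * (r * (Dk k.+1 * xk k u v)) =
  (r * Dk k.+1) ^+ 2 * (xk k.+1 u v * xk k u v) by ring.
by rewrite mulr_ge0_le0 // sqr_ge0.
Qed.

(** Rescaled by l2^-(k+1), the last two points tend to q s2 and q s2 / l2, whose product is positive
    unless s2 = 0. *)
Lemma s2_eq0 : s2 = 0.
Proof.
have cl := expr_cvg0S l1_ge0 l1_lt1; have cw := expr_cvg0S (ltW w_gt0) w_lt1.
have cl' := expr_cvg0 l1_ge0 l1_lt1.
have clw : (fun k => l1 ^+ k.+1 * w ^+ k.+1) @ \oo --> (0 : R).
  by have := cvgM cl cw; rewrite mulr0; exact.
have cl'w : (fun k => l1 ^+ k * w ^+ k.+1) @ \oo --> (0 : R).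
  by have := cvgM cl' cw; rewrite mulr0; exact.
pose dw k := w ^+ k.+1 - g11 * (l1 ^+ k.+1 * w ^+ k.+1) - c * l1 ^+ k.+1.
have cdw : dw @ \oo --> (0 : R).
  apply: (cvg_affine3 (a1 := 1) (a2 := - g11) (a3 := - c) cw clw cl) => k.
  by rewrite /dw; ring.
pose A k := x0 * dw k + p * (g12 * s2 * l1 ^+ k.+1 + s1 * (l1 ^+ k.+1 * w ^+ k.+1))
  + q * s2 + q * (g21 * s1 - g11 * s2) * l1 ^+ k.+1.
pose B k := x0 * dw k + p * (g12 * s2 * l1 ^+ k + s1 * (l1 ^+ k * w ^+ k.+1))
  + q * w * s2 + q * (g21 * s1 - g11 * s2) * w * l1 ^+ k.+1.
have cA : A @ \oo --> q * s2.
  apply: (cvg_affine3 (a1 := x0) (a3 := p * s1)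
    (a2 := p * g12 * s2 + q * (g21 * s1 - g11 * s2)) cdw cl clw) => k.
  by rewrite /A; ring.
have cB : B @ \oo --> q * w * s2.
  apply: (cvg_affine3 (a1 := x0) (a3 := p * s1)
    (a2 := p * g12 * s2 + q * (g21 * s1 - g11 * s2) * w * l1) cdw cl' cl'w) => k.
  by rewrite /B [l1 ^+ k.+1]exprS; ring.
have dwE k : dw k = Dk k.+1 * w ^+ k.+1.
  rewrite /dw /Dk /rho exprMn !mulrBl mul1r; congr (_ - _ - _); first by ring.
  by rewrite -!mulrA l2w mulr1.
have H : q * s2 * (q * w * s2) <= 0.
  apply: (opposite_limits (A := A) (B := B)) => // k u v _ fk.
  exists (w ^+ k.+1); rewrite (xk_end fk) (xk_pre fk) /A /B dwE.
  have e1 := l2w k.+1; have e0 := l2w k.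
  have e2 : l2 * w = 1 by rewrite mulfV // gt_eqF.
  rewrite /rho !exprMn !exprS in e1 *.
  set a := l1 ^+ k; set b := l2 ^+ k in e0 e1 *; set e := w ^+ k in e0 e1 *.
  set D := Dk _; split.
    (* Products of reciprocal powers, equal to 1, are inserted so that both sides match as
       polynomials. *)
    transitivity (x0 * (D * (w * e)) + p * (g12 * s2 * (l1 * a) *
      ((l2 * b) * (w * e)) + s1 * (l1 * a * (w * e))) + q * s2 * ((l2 * b) * (w * e))
      + q * (g21 * s1 - g11 * s2) * (l1 * a) * ((l2 * b) * (w * e))).
      by rewrite e1; ring.
    by ring.
  transitivity (x0 * (D * (w * e)) + p * (g12 * s2 * a *
      ((l2 * w) * (b * e)) + s1 * (a * (w * e))) + q * w * s2 * (b * e)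
      + q * (g21 * s1 - g11 * s2) * w * (l1 * a) * (b * e)).
    by rewrite e2 e0; ring.
  by ring.
apply/eqP/negP => /negP s20; move: H; apply/negP; rewrite -ltNge.
have -> : q * s2 * (q * w * s2) = (q * s2) ^+ 2 * w by ring.
by rewrite mulr_gt0 // exprn_even_gt0 //= mulf_neq0.
Unshelve. all: by end_near. Qed.


(** If rho < 1, both points tend to [x0]. If rho > 1, the determinant bound forces c = 0, and then
    either both points diverge on the same side or the terms in rho^k vanish and the first argument
    applies. *)
Lemma rho_eq1 : l1 * l2 = 1.
Proof.
rewrite -/rho.
have rho_ge0 : 0 <= rho by rewrite mulr_ge0 // ltW.
have cl := expr_cvg0S l1_ge0 l1_lt1; have cl' := expr_cvg0 l1_ge0 l1_lt1.
have cw := expr_cvg0S (ltW w_gt0) w_lt1.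
pose e0 := g21 * s1.
have endE k u v : fixk k u v -> Dk k * xk k u v =
    x0 * Dk k + p * s1 * l1 ^+ k + q * (e0 * rho ^+ k).
  by move=> /xk_end ->; rewrite s2_eq0 /e0; ring.
have preE k u v : fixk k.+1 u v -> Dk k.+1 * xk k u v =
    x0 * Dk k.+1 + p * s1 * l1 ^+ k + q * l1 * (e0 * rho ^+ k).
  by move=> /xk_pre ->; rewrite s2_eq0 /e0; ring.
(* Covers every case in which the terms in rho^k disappear in the limit. *)
have decay : (fun k => c * rho ^+ k) @ \oo --> (0 : R) ->
    (fun k => e0 * rho ^+ k) @ \oo --> (0 : R) -> False.
  move=> cc ce.
  have cD : Dk @ \oo --> (1 : R).
    apply: (cvg_affine3 (a1 := - g11) (a2 := - 1) (a3 := 0) cl' cc cc) => k.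
    by rewrite /Dk; ring.
  have cD1 : (fun k => Dk k - 1) @ \oo --> (0 : R).
    apply: (cvg_affine3 (a1 := - g11) (a2 := - 1) (a3 := 0) cl' cc cc) => k.
    by rewrite /Dk; ring.
  have cA : (fun k => x0 * Dk k + (p * s1 * l1 ^+ k + q * (e0 * rho ^+ k)))
      @ \oo --> x0.
    apply: (cvg_affine3 (a1 := x0) (a2 := p * s1) (a3 := q) cD1 cl' ce) => k.
    by ring.
  (* If x0 = 0, the point after the last pass tends to the switching manifold, and [m] is squeezed
     to 0. *)
  have [x00|x00] := eqVneq x0 0.
    apply: m_not0.
    have D0 : \forall k \near \oo, Dk k != 0 by exact: cvgr_neq0 cD (oner_neq0 _).
    have cxk : (fun k => `|(x0 * Dk k + (p * s1 * l1 ^+ k + q * (e0 * rho ^+ k)))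
        * (Dk k)^-1|) @ \oo --> (0 : R).
      have -> : 0 = `|x0 * 1^-1| by rewrite x00 mul0r normr0.
      by apply: cvg_norm; apply: cvgM cA (cvgV _ cD); exact: oner_neq0.
    have c0 : (fun=> 0 : R) @ \oo --> (0 : R) by exact: cvg_cst.
    apply: (squeeze_cvgr _ c0 cxk); near=> k.
    have Dk0 : Dk k != 0 by near: k.
    have := @Hm k; rewrite DkE => /(_ Dk0)[u [v [fk mk]]].
    rewrite m_ge0 /= (le_trans mk) // le_eqVlt; apply/orP; left; apply/eqP.
    by congr (`|_|); rewrite addrA -(endE _ _ _ fk) [_ * xk _ _ _]mulrC mulfK.
  pose A k := x0 * Dk k.+1 + (p * s1 * l1 ^+ k.+1 + q * (e0 * rho ^+ k.+1)).
  pose B k := x0 * Dk k.+1 + (p * s1 * l1 ^+ k + q * l1 * (e0 * rho ^+ k)).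
  (* Both points tend to [x0], yet they lie on opposite sides. *)
  have : x0 * x0 <= 0.
    apply: (opposite_limits (A := A) (B := B)).
    - move=> k u v _ fk; exists 1.
      by rewrite (endE _ _ _ fk) (preE _ _ _ fk) !mul1r /A /B -!addrA.
    - by rewrite (cvg_shiftS (fun k => _ * Dk k + (_ + _))).
    - have cD1' : (fun k => Dk k.+1 - 1) @ \oo --> (0 : R).
        by rewrite (cvg_shiftS (fun k => Dk k - 1)).
      apply: (cvg_affine3 (a1 := x0) (a2 := p * s1) (a3 := q * l1) cD1' cl' ce) => k.
      by rewrite /B; ring.
  apply/negP; rewrite -ltNge.
  by rewrite -expr2 exprn_even_gt0.
have [r1|r1|//] := ltgtP rho 1.
  have cr := expr_cvg0 rho_ge0 r1; exfalso; apply: decay.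
    by have := cvgMl_tmp (a := c) cr; rewrite mulr0; exact.
  by have := cvgMl_tmp (a := e0) cr; rewrite mulr0; exact.
have rho_gt0 : 0 < rho by exact: lt_trans r1.
pose z := rho^-1.
have rz k : rho ^+ k * z ^+ k = 1.
  by rewrite -exprMn mulfV ?expr1n // gt_eqF.
have cz : (fun k => z ^+ k.+1) @ \oo --> (0 : R).
  by apply: expr_cvg0S; rewrite ?invr_ge0 // invf_lt1.
(* The determinant is -c rho^(k+1), which must stay in [-1, 1] for arbitrarily large k. *)
have c0 : c = 0.
  apply/eqP/negP => /negP c0.
  have := cz => /cvgr_lt /(_ `|c|); rewrite normr_gt0 => /(_ c0) /often_near[k Kk].
  have [_ _ dk _] := HK Kk; have dk' := detk_ge Kk.
  apply/negP; rewrite -leNgt; have z_ge0 : 0 <= z ^+ k.+1.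
    by rewrite exprn_ge0 // invr_ge0.
  have -> : c = c * rho ^+ k.+1 * z ^+ k.+1 by rewrite -mulrA rz mulr1.
  rewrite normrM (ger0_norm z_ge0) ler_piMl // ler_norml.
  have dE : detk k.+1 = - (c * rho ^+ k.+1).
    by rewrite /detk g22_eq0 mulr0 sub0r mulNr.
  by rewrite dE in dk dk'; apply/andP; split; lra.
exfalso; have [e00|e00] := eqVneq e0 0.
  apply: decay; rewrite ?c0 ?e00; under eq_fun do rewrite mul0r; exact: cvg_cst.
pose A k := x0 * (z ^+ k.+1 - g11 * (l1 ^+ k.+1 * z ^+ k.+1))
  + p * s1 * (l1 ^+ k.+1 * z ^+ k.+1) + q * e0.
pose B k := x0 * (z ^+ k.+1 - g11 * (l1 ^+ k.+1 * z ^+ k.+1))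
  + p * s1 * (l1 ^+ k * z ^+ k.+1) + q * l1 * e0 * z.
have clz : (fun k => l1 ^+ k.+1 * z ^+ k.+1) @ \oo --> (0 : R).
  by have := cvgM cl cz; rewrite mulr0; exact.
have cl'z : (fun k => l1 ^+ k * z ^+ k.+1) @ \oo --> (0 : R).
  by have := cvgM cl' cz; rewrite mulr0; exact.
(* Rescaled by rho^-(k+1), both points have nonzero limits of the same sign; l1 is positive because
   rho is. *)
have : (q * e0) * (q * l1 * e0 * z) <= 0.
  apply: (opposite_limits (A := A) (B := B)).
  - move=> k u v _ fk; exists (z ^+ k.+1).
    rewrite (endE _ _ _ fk) (preE _ _ _ fk) /A /B /Dk c0.
    have e1 := rz k.+1; have e2 := rz k.
    split; first by rewrite -[q * e0]mulr1 -[X in q * e0 * X]e1; ring.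
    by rewrite -[q * l1 * e0]mulr1 -[X in q * l1 * e0 * X]e2 [z ^+ k.+1]exprS; ring.
  - apply: (cvg_affine3 (a1 := x0) (a2 := p * s1 - x0 * g11) (a3 := 0)
      cz clz clz) => k.
    by rewrite /A; ring.
  - apply: (cvg_affine3 (a1 := x0) (a2 := - x0 * g11) (a3 := p * s1)
      cz clz cl'z) => k.
    by rewrite /B; ring.
apply/negP; rewrite -ltNge.
have -> : q * e0 * (q * l1 * e0 * z) = (q * e0) ^+ 2 * (l1 * z) by ring.
rewrite mulr_gt0 //; first by rewrite exprn_even_gt0 //= mulf_neq0.
rewrite mulr_gt0 ?invr_gt0 // lt_neqAle l1_ge0 andbT; apply/eqP => l10.
by move: rho_gt0; rewrite /rho -l10 mul0r ltxx.
Unshelve. all: by end_near. Qed.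

(** With rho = 1 the determinant is -c for every k. If c = 1, stability forces the trace to be 0,
    making 1 an eigenvalue against uniqueness. *)
Lemma c_range : [/\ -1 <= g12 * g21, g12 * g21 <= 1 & g12 * g21 != 1].
Proof.
rewrite -/c.
have [k _ Kk] := Kinf 0; have [_ tk dk nd] := HK Kk; have dk' := detk_ge Kk.
have dE : detk k.+1 = - c.
  by rewrite /detk g22_eq0 rho_eq1 expr1n mulr0 sub0r mulr1.
rewrite dE in tk dk nd dk'; split; [lra|lra|].
apply/eqP => c1; move: tk nd; rewrite c1 subrr normr_le0 => /eqP ->.
by rewrite subr0 subrr eqxx.
Qed.

End CriticalRelations.

(** * Limit and reindexing tools *)

Lemma cvg0_bounded (R : realType) (T : Type) (F : set_system T) {FF : Filter F}
    (b f : T -> R) :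
  (\forall t \near F, `|b t| <= 1) -> f @ F --> (0 : R) ->
  (fun t => b t * f t) @ F --> (0 : R).
Proof.
move=> b1 /cvgr0Pnorm_le f0; apply/cvgr0Pnorm_le => d d0.
have := f0 d d0; apply: filter_app; apply: filterS b1 => t b1 fd.
by rewrite normrM (le_trans _ fd) // ler_piMl.
Qed.

Lemma cvg_near_eq (R : realType) (T : Type) (F : set_system T) {FF : Filter F}
    (f g : T -> R) (l : R) :
  (\forall t \near F, f t = g t) -> f @ F --> l -> g @ F --> l.
Proof.
move=> fg cf; apply: cvg_trans cf; exact: near_eq_cvg.
Qed.

(* Position j of a long orbit is matched with the same position of a longer one
   counted from the nearer end. *)
Lemma two_sided_decay_reindex (R : realType) (a b A B eta : R) :
  0 <= a -> a < 1 -> 0 <= b -> b < 1 -> 0 < eta ->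
  exists k0, forall k j k', (k0 <= k)%N -> (k <= k')%N -> (j <= k)%N ->
    exists j', [/\ (j' <= k')%N, (j' == k') = (j == k) &
    `|(A * a ^+ j + B * b ^+ (k - j)) - (A * a ^+ j' + B * b ^+ (k' - j'))| <= eta].
Proof.
move=> a0 a1 b0 b1 eta0.
have tail (z Z : R) : 0 <= z -> z < 1 -> exists N, forall m n : nat, (N <= m)%N ->
    (N <= n)%N -> `|Z * z ^+ m - Z * z ^+ n| <= eta.
  move=> z0 z1; have : (fun n => Z * z ^+ n) @ \oo --> (0 : R).
    have := cvgMl_tmp (a := Z) (cvg_expr (z := z) _); rewrite mulr0; apply.
    by rewrite ger0_norm.
  move=> /cvgr0Pnorm_le /(_ (eta / 2)); rewrite divr_gt0 // => /(_ isT)[N _ H].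
  exists N => m n Nm Nn; apply: (le_trans (ler_normB _ _)).
  by rewrite [eta in leRHS]splitr lerD //; exact: H.
have [Na Ha] := tail a A a0 a1; have [Nb Hb] := tail b B b0 b1.
(* Doubling guarantees that a position in one half is far enough from the opposite end for the other
   exponential to be negligible. *)
exists (Na + Nb).*2.+1 => k j k' kk0 kk' jk.
have [jk2|jk2] := ltnP j.*2 k.
  exists j; split; first exact: leq_trans jk kk'.
    have jlt : (j < k)%N by lia.
    by rewrite !ltn_eqF // (leq_trans jlt).
  by rewrite opprD addrACA subrr add0r; apply: Hb; lia.
(* Keeps the distance to the end, so the terms in [b] cancel; j = k is sent to j' = k'. *)
exists (k' - (k - j))%N; split; [lia|lia|].
have -> : (k' - (k' - (k - j)) = k - j)%N by lia.
by rewrite opprD addrACA subrr addr0; apply: Ha; lia.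
Qed.

Lemma near_all_ltn (T : Type) (F : set_system T) {FF : Filter F} n
    (P : nat -> T -> Prop) :
  (forall i, (i < n)%N -> \forall t \near F, P i t) ->
  \forall t \near F, forall i, (i < n)%N -> P i t.
Proof.
elim: n => [|n IH] H; first by apply: filterE.
have H1 := IH (fun i (h : (i < n)%N) => H i (ltnW h)).
have := H n (ltnSn n); apply: filter_app; apply: filterS H1 => t h hn i.
by rewrite ltnS leq_eqVlt => /orP[/eqP ->|/h].
Qed.

Lemma derive_lt0_decrease (R : realType) (f : R -> R) (a : R) :
  derivable f a 1 -> derive1 f a < 0 ->
  exists2 kappa, 0 < kappa &
    \forall e \near a, a < e -> f e <= f a - kappa * (e - a).
Proof.
(* Half of the slope is given up to absorb the error of the difference quotient. *)
move=> df f'0; exists (- (derive1 f a / 2)); first by lra.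
have : \forall h \near 0^', h^-1 *: (f (h *: 1 + a) - f a) <= derive1 f a / 2.
  have cf : h^-1 *: ((f \o shift a) (h *: 1) - f a) @[h --> 0^'] --> derive1 f a.
    by rewrite derive1E; exact: df.
  by apply: (cvgr_le _ cf); lra.
rewrite near_withinE => /nbhs_ballP[d /= d0 H].
near=> e => ae.
have ea : 0 < e - a by rewrite subr_gt0.
have : (e - a)^-1 *: (f ((e - a) *: 1 + a) - f a) <= derive1 f a / 2.
  apply: H => //; last by rewrite gt_eqF.
  rewrite /ball /= sub0r normrN distrC.
  by near: e; exact: (nbhsx_ballx a d d0).
rewrite [(e - a) *: 1]mulr1 subrK [_ *: _]mulrC ler_pdivrMr //; lra.
Unshelve. all: by end_near. Qed.

(** * Perturbation of the critical parameter *)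

Section Unfolding.
Context {R : realType}.
Variables (g11 g12 g21 g22 s1 s2 l1 l2 : R -> R).
Hypotheses (dg11 : derivable g11 0 1) (dg12 : derivable g12 0 1)
  (dg21 : derivable g21 0 1) (dg22 : derivable g22 0 1)
  (ds1 : derivable s1 0 1) (ds2 : derivable s2 0 1)
  (dl1 : derivable l1 0 1) (dl2 : derivable l2 0 1).
Let L := l2 0.
Hypotheses (L1 : 1 < L) (rho1 : l1 0 * l2 0 = 1) (g22_0 : g22 0 = 0)
  (s2_0 : s2 0 = 0).
Let c := g12 0 * g21 0.
Hypothesis c1 : c != 1.

Let L0 : 0 < L. Proof. exact: lt_trans L1. Qed.
Let l1E : l1 0 = L^-1.
Proof. by rewrite -[LHS]mulr1 -(mulfV (lt0r_neq0 L0)) mulrA rho1 mul1r. Qed.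
Let l1_gt0 : 0 < l1 0. Proof. by rewrite l1E invr_gt0. Qed.
Let l1_lt1 : l1 0 < 1. Proof. by rewrite l1E invf_lt1. Qed.

Local Notation F := (homoclinic L).
Local Instance F_proper : ProperFilter F := homoclinic_proper L1.

(** Normalised to equal 1 at e = 0: each power of an eigenvalue splits into its critical value and a
    factor tending to 1 by [homoclinic_pow]. *)
Let r1 e := l1 e / l1 0.
Let r2 e := l2 e / L.
Let dr1 : derivable r1 0 1.
Proof. by change r1 with (l1 * cst (l1 0)^-1); exact: (derivableM dl1 (derivable_cst _ _ _)). Qed.
Let dr2 : derivable r2 0 1.
Proof. by change r2 with (l2 * cst L^-1); exact: (derivableM dl2 (derivable_cst _ _ _)). Qed.
Let r1_0 : r1 0 = 1. Proof. by rewrite /r1 divff // gt_eqF. Qed.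
Let r2_0 : r2 0 = 1. Proof. by rewrite /r2 divff // gt_eqF. Qed.
Let l1X e n : l1 e ^+ n = l1 0 ^+ n * r1 e ^+ n.
Proof. by rewrite -exprMn /r1 mulrC divfK // gt_eqF. Qed.
Let l2X e n : l2 e ^+ n = L ^+ n * r2 e ^+ n.
Proof. by rewrite -exprMn /r2 mulrC divfK // gt_eqF. Qed.

Let near_j : \forall t \near F, (t.2 <= t.1.1)%N.
Proof. by exists 1, 0%N; split. Qed.
Let near_k : \forall t \near F, (t.1.1 <= t.1.1)%N.
Proof. exact: filterE. Qed.

Let r1k := homoclinic_pow L1 near_k dr1 r1_0.
Let r2k := homoclinic_pow L1 near_k dr2 r2_0.
Let r1j := homoclinic_pow L1 near_j dr1 r1_0.
Let r2j := homoclinic_pow L1 near_j dr2 r2_0.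

Let a_cvg : (fun t => l1 t.1.2 ^+ t.1.1) @ F --> (0 : R).
Proof.
have l1k : (fun t : nat * R * nat => l1 0 ^+ t.1.1) @ F --> (0 : R).
  apply: (cvg_comp _ _ (@homoclinic_k R L)).
  exact: expr_cvg0 (ltW l1_gt0) l1_lt1.
rewrite (funext (fun t : nat * R * nat => l1X t.1.2 t.1.1)).
by have := cvgM l1k r1k; rewrite mul0r; apply.
Qed.

Let cvg_l2k (f : R -> R) : derivable f 0 1 -> f 0 = 0 ->
  (fun t => f t.1.2 * l2 t.1.2 ^+ t.1.1) @ F --> (0 : R).
Proof.
move=> df f0.
have := cvgM (homoclinic_fL L1 df f0) r2k; rewrite mul0r => /(_ _).
rewrite (_ : (fun t => f t.1.2 * l2 t.1.2 ^+ t.1.1) =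
  (fun t : nat * R * nat => f t.1.2 * L ^+ t.1.1 * r2 t.1.2 ^+ t.1.1)) //.
by apply/funext => t; rewrite l2X mulrA.
Qed.

Let rho_cvg : (fun t => (l1 t.1.2 * l2 t.1.2) ^+ t.1.1) @ F --> (1 : R).
Proof.
have := cvgM r1k r2k; rewrite mulr1 => /(_ _).
rewrite (_ : (fun t => (l1 t.1.2 * l2 t.1.2) ^+ t.1.1) =
  (fun t : nat * R * nat => r1 t.1.2 ^+ t.1.1 * r2 t.1.2 ^+ t.1.1)) //.
apply/funext => t; rewrite exprMn l1X l2X mulrACA -exprMn rho1 expr1n.
by rewrite mul1r.
Qed.

Definition tr_t (t : nat * R * nat) :=
  g11 t.1.2 * l1 t.1.2 ^+ t.1.1 + g22 t.1.2 * l2 t.1.2 ^+ t.1.1.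
Definition det_t (t : nat * R * nat) :=
  (g11 t.1.2 * g22 t.1.2 - g12 t.1.2 * g21 t.1.2) * (l1 t.1.2 * l2 t.1.2) ^+ t.1.1.
Definition nondeg_t t := 1 - tr_t t + det_t t.

Let cv (f : R -> R) (df : derivable f 0 1) := homoclinic_derivable L1 df.

Lemma tr_cvg : tr_t @ F --> (0 : R).
Proof.
have := cvgD (cvgM (cv dg11) a_cvg) (cvg_l2k dg22 g22_0).
by rewrite mulr0 addr0; apply.
Qed.

Lemma det_cvg : det_t @ F --> - c.
Proof.
have := cvgM (cvgB (cvgM (cv dg11) (cv dg22)) (cvgM (cv dg12) (cv dg21))) rho_cvg.
by rewrite g22_0 mulr0 sub0r mulr1; apply.
Qed.

Lemma nondeg_cvg : nondeg_t @ F --> 1 - c.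
Proof.
have cst1 : (fun=> 1 : R) @ F --> (1 : R) by exact: cvg_cst.
by have := cvgD (cvgB cst1 tr_cvg) det_cvg; rewrite subr0; apply.
Qed.

Let c1' : 1 - c != 0. Proof. by rewrite subr_eq0 eq_sym. Qed.

Lemma near_nondeg : \forall t \near F, nondeg_t t != 0.
Proof. exact: cvgr_neq0 nondeg_cvg c1'. Qed.

(* Cramer's rule for the fixed point; the second unknown is l2^k v, the
   v-coordinate after the k passes of X, which converges as k grows. *)
Definition u_t (t : nat * R * nat) :=
  (s1 t.1.2 * (1 - g22 t.1.2 * l2 t.1.2 ^+ t.1.1)
   + g12 t.1.2 * (s2 t.1.2 * l2 t.1.2 ^+ t.1.1)) / nondeg_t t.
Definition v_t (t : nat * R * nat) :=
  ((1 - g11 t.1.2 * l1 t.1.2 ^+ t.1.1) * (s2 t.1.2 * l2 t.1.2 ^+ t.1.1)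
   + g21 t.1.2 * (l1 t.1.2 * l2 t.1.2) ^+ t.1.1 * s1 t.1.2) / nondeg_t t.

Lemma uv_tE k e j u v : nondeg_t (k, e, j) != 0 ->
  u = g11 e * (l1 e ^+ k * u) + g12 e * (l2 e ^+ k * v) + s1 e ->
  v = g21 e * (l1 e ^+ k * u) + g22 e * (l2 e ^+ k * v) + s2 e ->
  u = u_t (k, e, j) /\ l2 e ^+ k * v = v_t (k, e, j).
Proof.
move=> D0 /eqP; rewrite -subr_eq0 => /eqP eu /eqP; rewrite -subr_eq0 => /eqP ev.
rewrite /u_t /v_t /=; split; apply: canRL (mulfK D0) _;
  rewrite /nondeg_t /tr_t /det_t /= !exprMn;
  move: eu ev; set a := l1 e ^+ k; set b := l2 e ^+ k;
  set X := u - _; set Y := v - _ => eu ev; apply/eqP; rewrite -subr_eq0; apply/eqP.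
  transitivity (X * (1 - g22 e * b) + Y * (g12 e * b)).
    by rewrite /X /Y; ring.
  by rewrite eu ev !mul0r addr0.
transitivity (b * (Y * (1 - g11 e * a) + X * (g21 e * a))).
  by rewrite /X /Y; ring.
by rewrite eu ev !mul0r addr0 mulr0.
Qed.

(** [u0] is the limiting u-coordinate of the first point, [v0] the limiting v-coordinate after the k
    passes. *)
Let u0 := s1 0 / (1 - c).
Let v0 := g21 0 * s1 0 / (1 - c).

Lemma u_cvg : u_t @ F --> u0.
Proof.
have cst1 : (fun=> 1 : R) @ F --> (1 : R) by exact: cvg_cst.
have := cvgM (cvgD (cvgM (cv ds1) (cvgB cst1 (cvg_l2k dg22 g22_0)))
  (cvgM (cv dg12) (cvg_l2k ds2 s2_0))) (cvgV c1' nondeg_cvg).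
by rewrite subr0 mulr1 mulr0 addr0; apply.
Qed.

Lemma v_cvg : v_t @ F --> v0.
Proof.
have cst1 : (fun=> 1 : R) @ F --> (1 : R) by exact: cvg_cst.
have := cvgM (cvgD (cvgM (cvgB cst1 (cvgM (cv dg11) a_cvg)) (cvg_l2k ds2 s2_0))
  (cvgM (cvgM (cv dg21) rho_cvg) (cv ds1))) (cvgV c1' nondeg_cvg).
by rewrite mulr0 add0r mulr1; apply.
Qed.

Section Functional.
Variables (x0 p q : R -> R).
Hypotheses (dx0 : derivable x0 0 1) (dp : derivable p 0 1) (dq : derivable q 0 1).

(** Affine coordinate after j passes; l2^-k [v_t] recovers the v-coordinate of the first point. *)
Definition pos_t (t : nat * R * nat) := x0 t.1.2
  + p t.1.2 * (l1 t.1.2 ^+ t.2 * u_t t)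
  + q t.1.2 * (l2 t.1.2 ^+ t.2 * (l2 t.1.2 ^- t.1.1 * v_t t)).

(** The shadowed homoclinic orbit, decaying from both ends at the same rate: l2^(j-k) = l1^(k-j) at
    e = 0 because rho = 1. *)
Let lim_t (k j : nat) := x0 0 + (p 0 * u0 * l1 0 ^+ j + q 0 * v0 * l1 0 ^+ (k - j)).

(** Each deviation is a power of l1(0), bounded by 1, times a quantity tending to 0; hence
    uniformity in j. *)
Lemma pos_cvg : (fun t => pos_t t - lim_t t.1.1 t.2) @ F --> (0 : R).
Proof.
have h1 : (fun t => l1 0 ^+ t.2 * (p t.1.2 * u_t t * r1 t.1.2 ^+ t.2 - p 0 * u0))
    @ F --> (0 : R).
  apply: cvg0_bounded.
    apply: filterE => t; rewrite ger0_norm ?exprn_ge0 ?exprn_ile1 // ltW //.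
  have cc : (fun=> p 0 * u0) @ F --> p 0 * u0 by exact: cvg_cst.
  by have := cvgB (cvgM (cvgM (cv dp) u_cvg) r1j) cc; rewrite mulr1 subrr; apply.
have h2 : (fun t => l1 0 ^+ (t.1.1 - t.2) *
    (q t.1.2 * v_t t * (r2 t.1.2 ^+ t.2 * (r2 t.1.2 ^+ t.1.1)^-1) - q 0 * v0))
    @ F --> (0 : R).
  apply: cvg0_bounded.
    apply: filterE => t; rewrite ger0_norm ?exprn_ge0 ?exprn_ile1 // ltW //.
  have cc : (fun=> q 0 * v0) @ F --> q 0 * v0 by exact: cvg_cst.
  have := cvgB (cvgM (cvgM (cv dq) v_cvg) (cvgM r2j (cvgV (oner_neq0 _) r2k))) cc.
  by rewrite mulfV ?oner_neq0 // mulr1 subrr; apply.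
have h0 : (fun t : nat * R * nat => x0 t.1.2 - x0 0) @ F --> (0 : R).
  have cc : (fun=> x0 0) @ F --> x0 0 by exact: cvg_cst.
  by have := cvgB (cv dx0) cc; rewrite subrr; apply.
have := cvgD (cvgD h0 h1) h2; rewrite !addr0 => H.
move: H; set S := (X in X x @[x --> F] --> _) => H.
apply: (cvg_near_eq (f := S)); last exact: H.
near=> t; have jk : (t.2 <= t.1.1)%N by near: t.
rewrite /pos_t /lim_t (l1X t.1.2 t.2) (l2X t.1.2 t.2) (l2X t.1.2 t.1.1) invfM.
transitivity (x0 t.1.2 - x0 0
  + l1 0 ^+ t.2 * (p t.1.2 * u_t t * r1 t.1.2 ^+ t.2 - p 0 * u0)
  + l1 0 ^+ (t.1.1 - t.2) * (q t.1.2 * v_t t *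
    (r2 t.1.2 ^+ t.2 * (r2 t.1.2 ^+ t.1.1)^-1) - q 0 * v0)); first by [].
have -> : l1 0 ^+ (t.1.1 - t.2) = L ^+ t.2 * (L ^+ t.1.1)^-1.
  rewrite l1E exprVn -{2}(subnK jk) exprD invfM mulrC -mulrA mulVf ?mulr1 //.
  by rewrite expf_neq0 // gt_eqF.
ring.
Unshelve. all: by end_near. Qed.

(* [tail] selects the points after the last pass of X; the others lie on one of
   the k passes. The sign comes from one family of large k at e = 0 and the
   distance to 0 from another, which need not meet. *)
Lemma pos_sign (tail : bool) (sg d : R) : `|sg| = 1 -> 0 < d ->
  (forall N, exists2 k, (N <= k)%N & forall j, (j <= k)%N ->
     (j == k) = tail -> 0 <= sg * pos_t (k, 0, j)) ->
  (forall N, exists2 k, (N <= k)%N & forall j, (j <= k)%N ->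
     (j == k) = tail -> d <= `|pos_t (k, 0, j)|) ->
  \forall t \near F, (t.2 == t.1.1) = tail -> 0 < sg * pos_t t.
Proof.
move=> sg1 d0 HK Hd.
have e0 : 0 < d / 8 by rewrite divr_gt0.
have [D [k0 [D0 H]]] : F (fun t => `|pos_t t - lim_t t.1.1 t.2| <= d / 8).
  exact: (cvgr0_norm_le _ pos_cvg).
have [k1 Htr] := two_sided_decay_reindex (p 0 * u0) (q 0 * v0) (ltW l1_gt0) l1_lt1
  (ltW l1_gt0) l1_lt1 e0.
exists D, (maxn k0 k1); split=> // k e j; rewrite geq_max => /andP[kk0 kk1] e_ge0 eD jk.
move=> /= tl; have P1 := H k e j kk0 e_ge0 eD jk.
have near0 k' : (k <= k')%N -> (forall j', (j' <= k')%N ->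
    `|pos_t (k', 0, j') - lim_t k' j'| <= d / 8).
  move=> kk' j' jk'; apply: H => //; first exact: leq_trans kk'.
  by rewrite mulr_ge0 ?invr_ge0 ?exprn_ge0 // ltW.
(* Three errors of d/8: from (k, e, j) to its limit form, between the two limit forms, and back to a
   point at e = 0. *)
have lim_close k' : (k <= k')%N -> exists j', [/\ (j' <= k')%N, (j' == k') = tail &
    `|pos_t (k, e, j) - pos_t (k', 0, j')| <= 3 / 8 * d].
  move=> kk'; have [j' [jk' jt cl]] := Htr k j k' kk1 kk' jk.
  exists j'; split; rewrite ?jt // -/(lim_t _ _).
  have P2 := near0 k' kk' j' jk'.
  have {}cl : `|lim_t k j - lim_t k' j'| <= d / 8.
    by rewrite /lim_t opprD addrACA subrr add0r.
  move: P1 P2 cl; rewrite /= !ler_norml => /andP[? ?] /andP[? ?] /andP[? ?].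
  by apply/andP; split; lra.
have [k' kk' pk'] := HK k; have [j' [jk' jt cl']] := lim_close k' kk'.
have {}pk' := pk' j' jk' jt.
have [k2 kk2 pk2] := Hd k; have [j2 [jk2 jt2 cl2]] := lim_close k2 kk2.
have {}pk2 := pk2 j2 jk2 jt2.
(* Size d minus the error 3d/8. As 5/8 > 3/8, a value that is at least -3d/8 must then be
   positive. *)
have big : 5 / 8 * d <= `|pos_t (k, e, j)|.
  have := ler_normD (pos_t (k2, 0, j2) - pos_t (k, e, j)) (pos_t (k, e, j)).
  by rewrite subrK distrC; lra.
have sm : - (3 / 8 * d) <= sg * pos_t (k, e, j).
  have : `|sg * (pos_t (k, e, j) - pos_t (k', 0, j'))| <= 3 / 8 * d.
    by rewrite normrM sg1 mul1r.
  rewrite ler_norml mulrBr => /andP[? ?]; lra.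
have : 5 / 8 * d <= `|sg * pos_t (k, e, j)| by rewrite normrM sg1 mul1r.
by rewrite ler_normr => /orP[]; lra.
Qed.

End Functional.

(** The trace tends to 0 and the determinant to -c, so the limits decide except when c = -1. There
    the decay of rho(e)^k must beat the O(e) growth of det gamma, and strictness comes from e >
    0. *)
Lemma near_attracting : -1 <= c -> c < 1 ->
  (c = -1 -> derive1 l1 0 * l2 0 + l1 0 * derive1 l2 0 < 0) ->
  \forall t \near F, 0 < t.1.2 -> `|tr_t t| < 1 + det_t t /\ det_t t < 1.
Proof.
move=> c_ge cl1 Hneg.
have nT : \forall t \near F, `|tr_t t| < 1 + det_t t.
  have cst1 : (fun=> 1 : R) @ F --> (1 : R) by exact: cvg_cst.
  have cT : (fun t => 1 + det_t t - `|tr_t t|) @ F --> 1 - c.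
    by have := cvgB (cvgD cst1 det_cvg) (cvg_norm tr_cvg); rewrite normr0 subr0; apply.
  have c_lt : 0 < 1 - c by rewrite subr_gt0.
  have nT : \forall t \near F, 0 < 1 + det_t t - `|tr_t t| by exact: (cvgr_gt _ cT).
  by apply: filterS nT => t; rewrite subr_gt0.
suff nD : \forall t \near F, 0 < t.1.2 -> det_t t < 1.
  apply: filter_app nT; apply: filterS nD => t nD nT t0.
  by split => //; exact: nD.
have [cm1|cm1] := eqVneq c (-1); last first.
  have c_lt : - c < 1 by rewrite ltrNl lt_neqAle eq_sym cm1.
  have nd : \forall t \near F, det_t t < 1 by exact: (cvgr_lt _ det_cvg).
  by apply: filterS nd.
pose G e := g11 e * g22 e - g12 e * g21 e.
have dG : derivable G 0 1.
  change G with (g11 * g22 - g12 * g21).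
  exact: (derivableB (derivableM dg11 dg22) (derivableM dg12 dg21)).
pose rho e := l1 e * l2 e.
have rhoE : rho = l1 * l2 by [].
have drho : derivable rho 0 1 by rewrite rhoE; exact: (derivableM dl1 dl2).
have rho'0 : derive1 rho 0 < 0.
  rewrite rhoE derive1E (deriveM dl1 dl2) -!derive1E; move: (Hneg cm1); congr (_ < _).
  by rewrite addrC; congr (_ + _); rewrite mulrC.
have [C C0 HG] := derivable_lipschitz dG.
have [kp kp0 Hrho] := derive_lt0_decrease drho rho'0.
have rho_pos : \forall e \near 0, 0 < rho e.
  have /derivable1_diffP/differentiable_continuous crho := drho.
  by apply: (cvgr_gt _ crho); rewrite /rho rho1.
(* From here on k kp e exceeds the loss C e for every e > 0. *)
have nk : \forall t \near F, C / kp < t.1.1%:R.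
  have h : \forall k \near \oo, C / kp < k%:R by exact: nbhs_infty_gtr.
  exact: (@homoclinic_k R L) h.
have nG := homoclinic_near L1 HG; have nrho := homoclinic_near L1 Hrho.
have npos := homoclinic_near L1 rho_pos.
near=> t.
have kC : C / kp < t.1.1%:R by near: t.
have Ge0 : `|G t.1.2 - G 0| <= C * `|t.1.2 - 0| by near: t.
have re_le : 0 < t.1.2 -> rho t.1.2 <= rho 0 - kp * (t.1.2 - 0) by near: t.
have re0 : 0 < rho t.1.2 by near: t.
move: kC Ge0 re_le re0; set e := t.1.2; set k := t.1.1 => kC Ge0 re_le re0 t0.
have Ge : G e <= 1 + C * e.
  have G0 : G 0 = 1 by rewrite /G g22_0 mulr0 sub0r -/c cm1 opprK.
  by move: Ge0; rewrite G0 subr0 (gtr0_norm t0) ler_norml => /andP[_]; rewrite lerBlDl.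
have re : rho e <= 1 - kp * e.
  by have := re_le t0; rewrite {2}/rho rho1 subr0.
rewrite /det_t -/e -/k -/(G e) -/(rho e).
have rk0 : 0 <= rho e ^+ k by rewrite exprn_ge0 // ltW.
apply: (le_lt_trans (ler_wpM2r rk0 Ge)).
(* Exponentials merge both bounds into the single exponent C e - k kp e. *)
have rk : rho e ^+ k <= expR (- (k%:R * (kp * e))).
  rewrite -mulrN expRM_natl lerXn2r ?nnegrE ?expR_ge0 ?(ltW re0) //.
  by apply: (le_trans re); exact: expR_ge1Dx.
have Ce0 : 0 <= 1 + C * e by rewrite addr_ge0 // mulr_ge0 // ltW.
apply: (le_lt_trans (ler_wpM2l Ce0 rk)).
have := ler_wpM2r (expR_ge0 (- (k%:R * (kp * e)))) (expR_ge1Dx (C * e)).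
move=> /le_lt_trans; apply; rewrite -expRD expR_lt1.
have : C * e < k%:R * kp * e by rewrite ltr_pM2r // -ltr_pdivrMr.
lra.
Unshelve. all: by end_near. Qed.

End Unfolding.

(** * The family of S[k]-cycles *)

Section Signs.
Context {R : realType}.
Implicit Types (p : params R) (S : word).

(* Sign of x prescribed by a letter. *)
Definition sgl (J : letter) : R := if J is Rgt then 1 else -1.

Lemma norm_sgl J : `|sgl J| = 1.
Proof. by case: J; rewrite /= ?normrN normr1. Qed.

Lemma admissible_sgl p S :
  admissible p S -> forall i, (i < size S)%N -> 0 <= sgl (nth Lft S i) * cycle_x p S i.
Proof.
move=> aS i iS; have := aS i iS; case: (nth Lft S i) => /= h.
  by rewrite mulN1r oppr_ge0.
by rewrite mul1r.
Qed.

Lemma sgl_admissible p S :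
  (forall i, (i < size S)%N -> 0 < sgl (nth Lft S i) * cycle_x p S i) ->
  admissible p S /\ off_switching p S.
Proof.
move=> H; split=> i iS; have := H i iS; case: (nth Lft S i) => /=.
- by rewrite mulN1r oppr_gt0 => /ltW.
- by rewrite mul1r => /ltW.
- by rewrite mulN1r oppr_gt0 => /lt_eqF ->.
- by rewrite mul1r => /gt_eqF ->.
Qed.

Lemma head_sgl_opp (V W : word) (a b : R) : head Lft V <> head Lft W ->
  0 <= sgl (nth Lft V 0) * a -> 0 <= sgl (nth Lft W 0) * b -> b * a <= 0.
Proof. by rewrite !nth0; case: (head _ V); case: (head _ W) => //= _; nra. Qed.

End Signs.

(** * Cycle points read in eigencoordinates *)

Section Adapted.
Context {R : realType}.
Variables (p : params R) (X Y : word) (z1 z2 : 'cV[R]_2) (l1 l2 : R)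
  (G : 'M[R]_2) (s : 'cV[R]_2).

(** Bundles the eigencoordinate data at one parameter value, so that it can be used both at 0 and
    near 0. *)
Definition adapted : Prop :=
  [/\ is_eigenpair (Mword p X) l1 z1 /\ is_eigenpair (Mword p X) l2 z2,
      eigbasis z1 z2 \in unitmx, l1 != 1, l2 != 1 &
      forall z, uvcoord (eigbasis z1 z2) (cycle0 p X) (fword p Y z) =
        G *m uvcoord (eigbasis z1 z2) (cycle0 p X) z + s].

Hypothesis A : adapted.
Let Sk k := wpow X k ++ Y.
Let cyc k := uvcoord (eigbasis z1 z2) (cycle0 p X) (cycle0 p (Sk k)).

Lemma adapted_tr k : \tr (Mword p (Sk k)) = trk (G 0 0) (G 1 1) l1 l2 k.
Proof. by case: A => -[E1 E2] Qu _ _ HY; exact: tr_S E1 E2 Qu HY k. Qed.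

Lemma adapted_det k :
  \det (Mword p (Sk k)) = detk (G 0 0) (G 0 1) (G 1 0) (G 1 1) l1 l2 k.
Proof. by case: A => -[E1 E2] Qu _ _ HY; exact: det_S E1 E2 Qu HY k. Qed.

Lemma adapted_fixk k : unique_cycle p (Sk k) ->
  fixk (G 0 0) (G 0 1) (G 1 0) (G 1 1) (s 0 0) (s 1 0) l1 l2 k
    (cyc k 0 0) (cyc k 1 0).
Proof.
move=> [z [fz _]]; have /fword_cycle0 f : exists z, fword p (Sk k) z = z by exists z.
by case: A => -[E1 E2] Qu n1 n2 HY; exact: (fixed_uv E1 E2 Qu n1 n2 HY f).
Qed.

Lemma cycle_x_block k j i : (j < k)%N -> (i < size X)%N ->
  cycle_x p (Sk k) (j * size X + i) =
  xk l1 l2 (xcoord (fword p (take i X) (cycle0 p X)))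
    (xcoord (Mword p (take i X) *m z1)) (xcoord (Mword p (take i X) *m z2))
    j (cyc k 0 0) (cyc k 1 0).
Proof.
move=> jk iX; rewrite /cycle_x /cycle_pt take_block //.
by case: A => -[E1 E2] Qu n1 n2 HY; exact: (xcoord_powX E1 E2 Qu n1 n2).
Qed.

Lemma cycle_x_tail k i :
  cycle_x p (Sk k) (k * size X + i) =
  xk l1 l2 (xcoord (fword p (take i Y) (cycle0 p X)))
    (xcoord (Mword p (take i Y) *m z1)) (xcoord (Mword p (take i Y) *m z2))
    k (cyc k 0 0) (cyc k 1 0).
Proof.
rewrite /cycle_x /cycle_pt take_tail.
by case: A => -[E1 E2] Qu n1 n2 HY; exact: (xcoord_powX E1 E2 Qu n1 n2).
Qed.

End Adapted.

(** * The critical relations for actual cycles *)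

Section CriticalCase.
Context {R : realType}.
Variables (p : params R) (X Y : word) (z1 z2 : 'cV[R]_2) (l1 l2 : R)
  (G : 'M[R]_2) (s : 'cV[R]_2).
Hypothesis A : adapted p X Y z1 z2 l1 l2 G s.
Let Sk k := wpow X k ++ Y.
Hypotheses (l1_ge0 : 0 <= l1) (l1_lt1 : l1 < 1) (l2_gt1 : 1 < l2).
Hypotheses (X0 : X <> [::]) (Y0 : Y <> [::]) (hd : head Lft X <> head Lft Y).
Hypothesis z2x : ~ (exists c : R, z2 = c *: vec2 0 1).
Hypothesis inf : infinite_set [set k : nat | (1 <= k)%N /\
    [/\ unique_cycle p (Sk k), admissible p (Sk k),
        stable p (Sk k) & off_switching p (Sk k)]].
Hypothesis nlim : ~ ((fun k : nat => min_abs_x p (Sk k)) @ \oo --> (0 : R)).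

Let sX : (0 < size X)%N. Proof. by case: X X0. Qed.
Let sY : (0 < size Y)%N. Proof. by case: Y Y0. Qed.

(** Infinite sets of naturals are unbounded; writing the exponent as [k.+1] exposes the pass before
    the end. *)
Lemma infinite_often N : exists2 k, (N <= k)%N & [/\ unique_cycle p (Sk k.+1),
  admissible p (Sk k.+1) & stable p (Sk k.+1)].
Proof.
apply: contrapT => H; apply: inf.
apply: (@sub_finite_set _ _ `I_N.+1); last exact: finite_II.
move=> [|k] [] // _ [u a st _] /=; rewrite ltnS; case: (ltnP k N) => // Nk.
by exfalso; apply: H; exists k.
Qed.

Lemma critical_relations :
  [/\ G 1 1 = 0, s 1 0 = 0, l1 * l2 = 1 &
    [/\ -1 <= G 0 1 * G 1 0, G 0 1 * G 1 0 <= 1 & G 0 1 * G 1 0 != 1]].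
Proof.
pose K := [set k | [/\ unique_cycle p (Sk k.+1),
  admissible p (Sk k.+1) & stable p (Sk k.+1)]].
(* The empty prefix: the slope in v is then the x-component of z2, nonzero since z2 is not
   vertical. *)
pose xx := xk l1 l2 (xcoord (cycle0 p X)) (xcoord (1%:M *m z1)) (xcoord (1%:M *m z2)).
have q0 : xcoord (1%:M *m z2) != 0.
  apply/eqP; rewrite mul1mx /xcoord => z20; apply: z2x; exists (z2 1 0).
  by apply: colP2; rewrite !mxE /= ?mulr0 ?mulr1.
have tail0 k : cycle_x p (Sk k) (k * size X + 0) = xx k
    (uvcoord (eigbasis z1 z2) (cycle0 p X) (cycle0 p (Sk k)) 0 0)
    (uvcoord (eigbasis z1 z2) (cycle0 p X) (cycle0 p (Sk k)) 1 0).
  by rewrite (cycle_x_tail A) !take0.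
have block0 k : cycle_x p (Sk k.+1) (k * size X + 0) = xx k
    (uvcoord (eigbasis z1 z2) (cycle0 p X) (cycle0 p (Sk k.+1)) 0 0)
    (uvcoord (eigbasis z1 z2) (cycle0 p X) (cycle0 p (Sk k.+1)) 1 0).
  by rewrite (cycle_x_block A) // !take0.
have size_tail k : (k * size X + 0 < size (Sk k))%N.
  by rewrite size_cat size_wpow ltn_add2l.
have size_block k : (k * size X + 0 < size (Sk k.+1))%N.
  rewrite size_cat size_wpow addn0 mulSn -addnA addnC -addnA.
  by rewrite -[X in (X < _)%N]addn0 ltn_add2l addn_gt0 sY.
have KH k : K k -> [/\ exists u v : R,
       fixk (G 0 0) (G 0 1) (G 1 0) (G 1 1) (s 0 0) (s 1 0) l1 l2 k.+1 u v /\
       xx k.+1 u v * xx k u v <= 0,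
     `|trk (G 0 0) (G 1 1) l1 l2 k.+1| <=
        1 + detk (G 0 0) (G 0 1) (G 1 0) (G 1 1) l1 l2 k.+1,
     detk (G 0 0) (G 0 1) (G 1 0) (G 1 1) l1 l2 k.+1 <= 1
   & 1 - trk (G 0 0) (G 1 1) l1 l2 k.+1
     + detk (G 0 0) (G 0 1) (G 1 0) (G 1 1) l1 l2 k.+1 != 0].
  move=> [u a [_ _ st]]; have [tr1 det1] := jury_weak st.
  have /unique_cycleP nd := u.
  rewrite -(adapted_tr A) -(adapted_det A); split=> //.
  have fk := adapted_fixk A u; do 2 eexists; split; first exact: fk.
  rewrite -tail0 -block0.
  (* After k of the k+1 passes the next letter is X_0; after all of them it is Y_0. *)
  apply: (head_sgl_opp hd).
    by have := admissible_sgl a (size_block k); rewrite nth_block.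
  by have := admissible_sgl a (size_tail k.+1); rewrite nth_tail.
have Hm k : 1 - trk (G 0 0) (G 1 1) l1 l2 k
     + detk (G 0 0) (G 0 1) (G 1 0) (G 1 1) l1 l2 k != 0 -> exists u v : R,
    fixk (G 0 0) (G 0 1) (G 1 0) (G 1 1) (s 0 0) (s 1 0) l1 l2 k u v /\
    min_abs_x p (Sk k) <= `|xx k u v|.
  rewrite -(adapted_tr A) -(adapted_det A) => /unique_cycleP u.
  have fk := adapted_fixk A u; do 2 eexists; split; first exact: fk.
  by rewrite -tail0; apply: min_abs_x_le.
have m0 k : 0 <= min_abs_x p (Sk k) by exact: min_abs_x_ge0.
split.
- exact: (g22_eq0 l1_ge0 l1_lt1 l2_gt1 infinite_often KH).
- exact: (s2_eq0 l1_ge0 l1_lt1 l2_gt1 q0 infinite_often KH).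
- exact: (rho_eq1 l1_ge0 l1_lt1 l2_gt1 q0 infinite_often KH m0 nlim Hm).
- exact: (c_range l1_ge0 l1_lt1 l2_gt1 q0 infinite_often KH m0 nlim Hm).
Qed.

End CriticalCase.

(** Failure of convergence bounds only a subsequence from below, which may avoid the stable
    cycles. *)
Lemma not_cvg0_often (R : realType) (m : nat -> R) : (forall k, 0 <= m k) ->
  ~ m @ \oo --> (0 : R) ->
  exists2 d, 0 < d & forall N, exists2 k, (N <= k)%N & d <= m k.
Proof.
move=> m0 nc; apply: contrapT => H; apply: nc; apply/cvgr0Pnorm_lt => d d0.
apply: contrapT => nd; apply: H; exists d => // N; apply: contrapT => H.
apply: nd; exists N => // k /= Nk; rewrite ger0_norm // ltNge; apply/negP => dk.
by apply: H; exists k.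
Qed.

Lemma derivable_near_neq (R : realType) (f : R -> R) (a b : R) :
  derivable f a 1 -> f a != b -> \forall e \near a, f e != b.
Proof.
move=> /derivable1_diffP/differentiable_continuous cf fab.
have cb : (fun e => f e - b) @ a --> f a - b by apply: cvgB => //; exact: cvg_cst.
have nb : \forall e \near a, f e - b != 0.
  by apply: cvgr_neq0 cb _; rewrite subr_eq0.
by apply: filterS nb => e; rewrite subr_eq0.
Qed.

(** Dependent eigenvectors would be multiples of each other and so share their eigenvalue. *)
Lemma eigbasis_unit (R : realType) (M : 'M[R]_2) (l1 l2 : R) (z1 z2 : 'cV[R]_2) :
  is_eigenpair M l1 z1 -> is_eigenpair M l2 z2 -> l1 != l2 ->
  eigbasis z1 z2 \in unitmx.
Proof.
move=> [z10 e1] [z20 e2] l12; rewrite unitmxE unitfE det_mx2.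
rewrite !(eigbasisE _ _ _).1 !(eigbasisE _ _ _).2; apply/eqP => d0.
have [i zi] : exists i, z2 i 0 != 0.
  apply/existsP; apply: contra_neqT z20 => /existsPn z20.
  by apply/colP => i; rewrite mxE; apply/eqP/negbNE/z20.
have z1E : z1 = (z1 i 0 / z2 i 0) *: z2.
  have H j : z1 j 0 * z2 i 0 = z1 i 0 * z2 j 0.
    move: d0 => /eqP; rewrite subr_eq0 => /eqP d0.
    have I2 (k : 'I_2) : k = 0 \/ k = 1.
      case: (unliftP ord0 k) => [m|] ->; last by left.
      by right; apply/val_inj; rewrite /= ord1.
    case: (I2 i) => ->; case: (I2 j) => -> //.
      by rewrite mulrC -d0.
    by rewrite d0 mulrC.
  by apply/colP => j; rewrite !mxE mulrAC -H mulfK.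
have r0 : z1 i 0 / z2 i 0 != 0.
  by apply: contra_neq z10 => r0; rewrite z1E r0 scale0r.
have : (l1 - l2) *: z1 = 0.
  by rewrite scalerBl -e1 {1}z1E -scalemxAr e2 scalerA mulrC -scalerA -z1E subrr.
by apply/eqP; rewrite scaler_eq0 subr_eq0 (negPf l12) (negPf z10).
Qed.

(** * Smooth dependence of the data and assembly of the family *)

Section Family.
Context {R : realType}.
Variables (mu : R) (tL dL tR dR : R -> R) (X Y : word)
  (lambda1 lambda2 : R -> R) (zeta1 zeta2 : R -> 'cV[R]_2)
  (gamma : R -> 'M[R]_2) (sigma : R -> 'cV[R]_2).
Let p := fun e : R => Params (tL e) (dL e) (tR e) (dR e) mu.
Hypotheses (dtL : derivable tL 0 1) (ddL : derivable dL 0 1)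
  (dtR : derivable tR 0 1) (ddR : derivable dR 0 1).
Hypotheses (dz1 : derivable_mx zeta1 0) (dz2 : derivable_mx zeta2 0).
Hypothesis near_eig : \forall e \near (0 : R),
     is_eigenpair (Mword (p e) X) (lambda1 e) (zeta1 e) /\
     is_eigenpair (Mword (p e) X) (lambda2 e) (zeta2 e).
Hypothesis near_Y : \forall e \near (0 : R), forall z : 'cV[R]_2,
  uvcoord (eigbasis (zeta1 e) (zeta2 e)) (cycle0 (p e) X) (fword (p e) Y z) =
  gamma e *m uvcoord (eigbasis (zeta1 e) (zeta2 e)) (cycle0 (p e) X) z + sigma e.
Hypotheses (l1_lt1 : lambda1 0 < 1) (l2_gt1 : 1 < lambda2 0).

Let adapt e := adapted (p e) X Y (zeta1 e) (zeta2 e) (lambda1 e) (lambda2 e)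
  (gamma e) (sigma e).
Let Q e := eigbasis (zeta1 e) (zeta2 e).

Lemma derivable_lambda1 : derivable lambda1 0 1.
Proof.
apply: (derivable_eigenvalue (M := fun e => Mword (p e) X) _ dz1).
  exact: (derivable_Mword dtL ddL dtR ddR).
by apply: filterS near_eig => e [].
Qed.

Lemma derivable_lambda2 : derivable lambda2 0 1.
Proof.
apply: (derivable_eigenvalue (M := fun e => Mword (p e) X) _ dz2).
  exact: (derivable_Mword dtL ddL dtR ddR).
by apply: filterS near_eig => e [].
Qed.

Let dQ : derivable_mx Q 0. Proof. exact: derivable_eigbasis. Qed.

Lemma unit_Q0 : Q 0 \in unitmx.
Proof.
have [E1 E2] := nbhs_singleton near_eig; apply: (eigbasis_unit E1 E2).
by rewrite lt_eqF // (lt_trans l1_lt1).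
Qed.

Lemma near_adapted : \forall e \near (0 : R), adapt e.
Proof.
have n1 : \forall e \near (0 : R), lambda1 e != 1.
  by apply: (derivable_near_neq derivable_lambda1); rewrite lt_eqF.
have n2 : \forall e \near (0 : R), lambda2 e != 1.
  by apply: (derivable_near_neq derivable_lambda2); rewrite gt_eqF.
have nQ : \forall e \near (0 : R), \det (Q e) != 0.
  apply: (derivable_near_neq (derivable_det2 dQ)).
  by rewrite -unitfE -unitmxE unit_Q0.
near=> e; split.
- by near: e.
- by rewrite unitmxE unitfE; near: e.
- by near: e.
- by near: e.
- by near: e.
Unshelve. all: by end_near. Qed.

Let adapt0 : adapt 0. Proof. exact: nbhs_singleton near_adapted. Qed.

Lemma derivable_fixed_point : derivable_mx (fun e => cycle0 (p e) X) 0.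
Proof.
case: adapt0 => -[E1 E2] Qu n1 n2 _.
exact: (derivable_cycle0 dtL ddL dtR ddR (MwordX_nondeg E1 E2 Qu n1 n2)).
Qed.

(** [gamma] is given only through its defining relation; the conjugation formula, valid near 0,
    makes it differentiable. *)
Lemma derivable_gamma : derivable_mx gamma 0.
Proof.
move=> i j; apply: (@near_eq_derivable _ _ _
    (fun e => (invmx (Q e) *m Mword (p e) Y *m Q e) i j)).
  have na := near_adapted; near=> e.
  have [_ Qu _ _ HY] : adapt e by near: e.
  by rewrite (gammaE Qu HY).
apply: derivable_mx_mul; last exact: dQ.
apply: derivable_mx_mul; last exact: (derivable_Mword dtL ddL dtR ddR).
exact: (derivable_mx_inv dQ unit_Q0).
Unshelve. all: by end_near. Qed.

Lemma derivable_sigma : derivable_mx sigma 0.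
Proof.
move=> i j; apply: (@near_eq_derivable _ _ _ (fun e =>
    (invmx (Q e) *m (fword (p e) Y (cycle0 (p e) X) - cycle0 (p e) X)) i j)).
  have na := near_adapted; near=> e.
  have [_ _ _ _ HY] : adapt e by near: e.
  by rewrite (sigmaE HY).
have dz := derivable_fixed_point.
apply: derivable_mx_mul; first exact: (derivable_mx_inv dQ unit_Q0).
apply: (@derivable_mx_add _ _ _ (fun e => fword (p e) Y (cycle0 (p e) X))).
  exact: (derivable_fword dtL ddL dtR ddR dz).
exact: (derivable_mx_opp dz).
Unshelve. all: by end_near. Qed.

Let const_x P e := xcoord (fword (p e) P (cycle0 (p e) X)).
Let slope1 P e := xcoord (Mword (p e) P *m zeta1 e).
Let slope2 P e := xcoord (Mword (p e) P *m zeta2 e).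

Lemma derivable_const_x P : derivable (const_x P) 0 1.
Proof. exact: (derivable_fword dtL ddL dtR ddR derivable_fixed_point). Qed.

Lemma derivable_slope1 P : derivable (slope1 P) 0 1.
Proof.
have h : derivable_mx (fun e => Mword (p e) P *m zeta1 e) 0.
  apply: derivable_mx_mul; last exact: dz1.
  exact: (derivable_Mword dtL ddL dtR ddR).
exact: (h 0 0).
Qed.

Lemma derivable_slope2 P : derivable (slope2 P) 0 1.
Proof.
have h : derivable_mx (fun e => Mword (p e) P *m zeta2 e) 0.
  apply: derivable_mx_mul; last exact: dz2.
  exact: (derivable_Mword dtL ddL dtR ddR).
exact: (h 0 0).
Qed.

Let g i j := fun e => gamma e i j.
Let s i := fun e => sigma e i 0.
Let Sk k := wpow X k ++ Y.
Let pos P := pos_t (g 0 0) (g 0 1) (g 1 0) (g 1 1) (s 0) (s 1) lambda1 lambda2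
  (const_x P) (slope1 P) (slope2 P).
Let nondeg := nondeg_t (g 0 0) (g 0 1) (g 1 0) (g 1 1) lambda1 lambda2.

Lemma unique_nondeg k e j : adapt e ->
  unique_cycle (p e) (Sk k) <-> nondeg (k, e, j) != 0.
Proof.
move=> A; rewrite /nondeg /nondeg_t /tr_t /det_t /=.
have := adapted_tr A k; rewrite /trk => <-; have := adapted_det A k.
by rewrite /detk => <-; exact: unique_cycleP.
Qed.

Lemma xk_pos P k j e : adapt e -> lambda2 e != 0 -> unique_cycle (p e) (Sk k) ->
  xk (lambda1 e) (lambda2 e) (const_x P e) (slope1 P e) (slope2 P e) j
    (uvcoord (Q e) (cycle0 (p e) X) (cycle0 (p e) (Sk k)) 0 0)
    (uvcoord (Q e) (cycle0 (p e) X) (cycle0 (p e) (Sk k)) 1 0) = pos P (k, e, j).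
Proof.
move=> A l20 u; have /(unique_nondeg k j A) nd := u.
have [f1 f2] := adapted_fixk A u.
have [uE vE] := @uv_tE _ (g 0 0) (g 0 1) (g 1 0) (g 1 1) (s 0) (s 1)
  lambda1 lambda2 k e j _ _ nd f1 f2; rewrite /pos /pos_t /xk /= -uE -vE.
by rewrite [lambda2 e ^- k * _]mulrA mulVf ?mul1r // expf_neq0.
Qed.

Lemma cycle_x_pos_block k j i e : adapt e -> lambda2 e != 0 ->
  unique_cycle (p e) (Sk k) -> (j < k)%N -> (i < size X)%N ->
  cycle_x (p e) (Sk k) (j * size X + i) = pos (take i X) (k, e, j).
Proof.
by move=> A l20 u jk iX; rewrite -(xk_pos _ _ A l20 u) (cycle_x_block A).
Qed.

Lemma cycle_x_pos_tail k i e : adapt e -> lambda2 e != 0 ->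
  unique_cycle (p e) (Sk k) ->
  cycle_x (p e) (Sk k) (k * size X + i) = pos (take i Y) (k, e, k).
Proof.
by move=> A l20 u; rewrite -(xk_pos _ _ A l20 u) (cycle_x_tail A).
Qed.

Hypothesis l1_ge0 : 0 <= lambda1 0.
Hypotheses (X0 : X <> [::]) (Y0 : Y <> [::]) (hd : head Lft X <> head Lft Y).
Hypothesis z2x : ~ (exists c : R, zeta2 0 = c *: vec2 0 1).
Hypothesis inf : infinite_set [set k : nat | (1 <= k)%N /\
    [/\ unique_cycle (p 0) (Sk k), admissible (p 0) (Sk k),
        stable (p 0) (Sk k) & off_switching (p 0) (Sk k)]].
Hypothesis nlim : ~ ((fun k : nat => min_abs_x (p 0) (Sk k)) @ \oo --> (0 : R)).

Let crit := critical_relations adapt0 l1_ge0 l1_lt1 l2_gt1 X0 Y0 hd z2x inf nlim.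
Local Notation F := (homoclinic (lambda2 0)).

Let near_nd : \forall t \near F, nondeg t != 0.
Proof.
have [g22 _ rho [_ _ c1]] := crit.
have dg := derivable_gamma.
exact: (near_nondeg (dg 0 0) (dg 0 1) (dg 1 0) (dg 1 1)
  derivable_lambda1 derivable_lambda2 l2_gt1 rho g22 c1).
Qed.

(** The filter includes e = 0 for all large k. Uniqueness there makes [min_abs_x] a statement about
    genuine cycle points. *)
Lemma unique_at0 : exists k0, forall k, (k0 <= k)%N -> unique_cycle (p 0) (Sk k).
Proof.
have [D [k0 [D0 H]]] := near_nd; exists k0 => k k0k.
apply/(unique_nondeg k 0 adapt0); apply: H => //.
by rewrite mulr_ge0 ?invr_ge0 ?exprn_ge0 ?(ltW D0) // ltW // (lt_trans _ l2_gt1).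
Qed.

Let l2_neq0 : lambda2 0 != 0.
Proof. by rewrite gt_eqF // (lt_trans _ l2_gt1). Qed.

Lemma near_sign_block i : (i < size X)%N -> \forall t \near F,
  (t.2 == t.1.1) = false -> 0 < sgl (nth Lft X i) * pos (take i X) t.
Proof.
move=> iX; have [g22 s2 rho [_ _ c1]] := crit.
have dg := derivable_gamma; have ds := derivable_sigma.
have [k0 uniq0] := unique_at0.
have [d d0 often_d] := not_cvg0_often (fun k => min_abs_x_ge0 (p 0) (Sk k)) nlim.
have szb k j : (j < k)%N -> (j * size X + i < size (Sk k))%N.
  move=> jk; rewrite size_cat size_wpow ltn_addr //.
  apply: (@leq_trans (j.+1 * size X)); first by rewrite mulSn addnC ltn_add2r.
  by rewrite leq_mul2r jk orbT.
apply: (@pos_sign _ (g 0 0) (g 0 1) (g 1 0) (g 1 1) (s 0) (s 1) lambda1 lambda2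
  (dg 0 0) (dg 0 1) (dg 1 0) (dg 1 1) (ds 0 0) (ds 1 0)
  derivable_lambda1 derivable_lambda2 l2_gt1 rho g22 s2 c1 _ _ _
  (@derivable_const_x (take i X)) (@derivable_slope1 (take i X))
  (@derivable_slope2 (take i X)) false _ d (norm_sgl (nth Lft X i)) d0).
(* The weak sign at e = 0 comes from the admissible cycles. *)
- move=> N; have [k Nk [u a _]] := infinite_often inf N.
  exists k.+1 => [|j jk jk']; first exact: leqW.
  have {}jk : (j < k.+1)%N by rewrite ltn_neqAle jk' jk.
  have := admissible_sgl a (szb _ _ jk); rewrite nth_block //.
  by rewrite (cycle_x_pos_block adapt0 l2_neq0 u jk iX).
(* The distance from 0 comes from the other subsequence, taken beyond [k0] so that the cycles are
   unique. *)
- move=> N; have [k Nk dk] := often_d (maxn N k0).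
  move: Nk; rewrite geq_max => /andP[Nk k0k]; exists k => // j jk jk'.
  have {}jk : (j < k)%N by rewrite ltn_neqAle jk' jk.
  rewrite -[pos_t _ _ _ _ _ _ _ _ _ _ _ _]/(pos (take i X) (k, 0, j)).
  rewrite -(cycle_x_pos_block adapt0 l2_neq0 (uniq0 k k0k) jk iX).
  by apply: (le_trans dk); apply: min_abs_x_le; exact: szb.
Qed.

Lemma near_sign_tail i : (i < size Y)%N -> \forall t \near F,
  (t.2 == t.1.1) = true -> 0 < sgl (nth Lft Y i) * pos (take i Y) t.
Proof.
move=> iY; have [g22 s2 rho [_ _ c1]] := crit.
have dg := derivable_gamma; have ds := derivable_sigma.
have [k0 uniq0] := unique_at0.
have [d d0 often_d] := not_cvg0_often (fun k => min_abs_x_ge0 (p 0) (Sk k)) nlim.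
have szt k : (k * size X + i < size (Sk k))%N.
  by rewrite size_cat size_wpow ltn_add2l.
apply: (@pos_sign _ (g 0 0) (g 0 1) (g 1 0) (g 1 1) (s 0) (s 1) lambda1 lambda2
  (dg 0 0) (dg 0 1) (dg 1 0) (dg 1 1) (ds 0 0) (ds 1 0)
  derivable_lambda1 derivable_lambda2 l2_gt1 rho g22 s2 c1 _ _ _
  (@derivable_const_x (take i Y)) (@derivable_slope1 (take i Y))
  (@derivable_slope2 (take i Y)) true _ d (norm_sgl (nth Lft Y i)) d0).
- move=> N; have [k Nk [u a _]] := infinite_often inf N.
  exists k.+1 => [|j _ /eqP ->]; first exact: leqW.
  have := admissible_sgl a (szt _); rewrite nth_tail //.
  by rewrite (cycle_x_pos_tail i adapt0 l2_neq0 u).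
- move=> N; have [k Nk dk] := often_d (maxn N k0).
  move: Nk; rewrite geq_max => /andP[Nk k0k]; exists k => // j _ /eqP ->.
  rewrite -[pos_t _ _ _ _ _ _ _ _ _ _ _ _]/(pos (take i Y) (k, 0, k)).
  rewrite -(cycle_x_pos_tail i adapt0 l2_neq0 (uniq0 k k0k)).
  by apply: (le_trans dk); exact: min_abs_x_le.
Qed.

Hypothesis Hneg : gamma 0 0 1 * gamma 0 1 0 = -1 ->
  derive1 lambda1 0 * lambda2 0 + lambda1 0 * derive1 lambda2 0 < 0.

(** X and Y have finitely many offsets, so one choice of D and k0 serves them all. *)
Lemma near_conclusion : \forall t \near F, [/\ adapt t.1.2, lambda2 t.1.2 != 0,
  nondeg t != 0,
  (forall i, (i < size X)%N ->
    (t.2 == t.1.1) = false -> 0 < sgl (nth Lft X i) * pos (take i X) t) /\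
  (forall i, (i < size Y)%N ->
    (t.2 == t.1.1) = true -> 0 < sgl (nth Lft Y i) * pos (take i Y) t) &
  (0 < t.1.2 -> `|\tr (Mword (p t.1.2) (Sk t.1.1))| <
     1 + \det (Mword (p t.1.2) (Sk t.1.1)) /\
     \det (Mword (p t.1.2) (Sk t.1.1)) < 1)].
Proof.
have FF := homoclinic_proper l2_gt1.
have nA := homoclinic_near l2_gt1 near_adapted.
have nl := homoclinic_near l2_gt1 (derivable_near_neq derivable_lambda2 l2_neq0).
have nb : \forall t \near F, forall i, (i < size X)%N ->
    (t.2 == t.1.1) = false -> 0 < sgl (nth Lft X i) * pos (take i X) t.
  exact: (near_all_ltn near_sign_block).
have nt : \forall t \near F, forall i, (i < size Y)%N ->
    (t.2 == t.1.1) = true -> 0 < sgl (nth Lft Y i) * pos (take i Y) t.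
  exact: (near_all_ltn near_sign_tail).
have dg := derivable_gamma.
have [g22 _ rho [cm cM c1]] := crit.
have c_lt1 : gamma 0 0 1 * gamma 0 1 0 < 1 by rewrite lt_neqAle c1.
have na := near_attracting (dg 0 0) (dg 0 1) (dg 1 0) (dg 1 1)
  derivable_lambda1 derivable_lambda2 l2_gt1 rho g22 cm c_lt1 Hneg.
near=> t.
have A : adapt t.1.2 by near: t.
split; [exact: A|by near: t|by near: t| |].
  by split; near: t.
by rewrite (adapted_tr A) (adapted_det A); near: t.
Unshelve. all: by end_near. Qed.

Lemma attracting_family : exists (kmin : int) (Delta : R), 0 < Delta /\
    forall (k : nat) (e : R), kmin <= k%:Z ->
      0 < e -> e <= Delta * lambda2 0 ^- k ->
      [/\ unique_cycle (p e) (Sk k), admissible (p e) (Sk k)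
        & attracting (p e) (Sk k)].
Proof.
have [D [k0 [D0 H]]] := near_conclusion.
exists k0%:Z, D; split=> // k e k0k e0 eD.
(* The same k and e serve every pass j <= k; conditions independent of j are read off at j = k. *)
have {}H j jk := H k e j k0k (ltW e0) eD jk.
have [A l20 nd _ /(_ e0)[T1 d1]] := H k (leqnn k).
have u : unique_cycle (p e) (Sk k) by apply/(unique_nondeg k k A).
have [adm off] : admissible (p e) (Sk k) /\ off_switching (p e) (Sk k).
  apply: sgl_admissible => idx /index_cases[[j [i [jk iX ->]]]|[i iY ->]].
    rewrite nth_block // (cycle_x_pos_block A l20 u jk iX).
    have [_ _ _ [Hb _] _] := H j (ltnW jk).
    by apply: Hb => //=; rewrite ltn_eqF.
  rewrite nth_tail (cycle_x_pos_tail i A l20 u).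
  have [_ _ _ [_ Ht] _] := H k (leqnn k).
  by apply: Ht => //=; rewrite eqxx.
by split=> //; split=> // z; exact: jury_strict.
Qed.

End Family.

Theorem lemma3p3 (R : realType) (mu : R) (tL dL tR dR : R -> R) (X Y : word)
    (lambda1 lambda2 : R -> R) (zeta1 zeta2 : R -> 'cV[R]_2)
    (gamma : R -> 'M[R]_2) (sigma : R -> 'cV[R]_2) :
  let p := fun e : R => Params (tL e) (dL e) (tR e) (dR e) mu in
  let S := fun k : nat => wpow X k ++ Y in
  let uv := fun e : R =>
    uvcoord (eigbasis (zeta1 e) (zeta2 e)) (cycle0 (p e) X) in
  mu != 0 ->
  smooth_near0 tL -> smooth_near0 dL -> smooth_near0 tR -> smooth_near0 dR ->
  primitive X -> Y <> [::] -> head Lft X <> head Lft Y ->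
  smooth_vec_near0 zeta1 -> smooth_vec_near0 zeta2 ->
  (\forall e \near (0 : R),
     is_eigenpair (Mword (p e) X) (lambda1 e) (zeta1 e) /\
     is_eigenpair (Mword (p e) X) (lambda2 e) (zeta2 e)) ->
  (\forall e \near (0 : R), forall z : 'cV[R]_2,
     uv e (fword (p e) Y z) = gamma e *m uv e z + sigma e) ->
  infinite_set [set k : nat | (1 <= k)%N /\
    [/\ unique_cycle (p 0) (S k), admissible (p 0) (S k),
        stable (p 0) (S k) & off_switching (p 0) (S k)]] ->
  0 <= lambda1 0 -> lambda1 0 < 1 -> 1 < lambda2 0 ->
  ~ (exists c : R, zeta2 0 = c *: vec2 0 1) ->
  ~ ((fun k : nat => min_abs_x (p 0) (S k)) @ \oo --> (0 : R)) ->
  (gamma 0 0 1 * gamma 0 1 0 = -1 ->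
     derive1 lambda1 0 * lambda2 0 + lambda1 0 * derive1 lambda2 0 < 0) ->
  exists (kmin : int) (Delta : R), 0 < Delta /\
    forall (k : nat) (e : R), kmin <= k%:Z ->
      0 < e -> e <= Delta * lambda2 0 ^- k ->
      [/\ unique_cycle (p e) (S k), admissible (p e) (S k)
        & attracting (p e) (S k)].
Proof.
move=> p S uv _ /smooth_near0_derivable dtL /smooth_near0_derivable ddL.
move=> /smooth_near0_derivable dtR /smooth_near0_derivable ddR [X0 _] Y0 hd.
move=> sz1 sz2 nE nY inf l10 l11 l21 z2x nlim Hneg.
have dmx (z : R -> 'cV[R]_2) : smooth_vec_near0 z -> derivable_mx z 0.
  by move=> sz i j; rewrite ord1; exact: smooth_near0_derivable (sz i).
exact: (attracting_family dtL ddL dtR ddR (dmx _ sz1) (dmx _ sz2) nE nY l11 l21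
  l10 X0 Y0 hd z2x inf nlim Hneg).
Qed.
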